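(* Let $(\mathrm{P})$–$(\mathrm{D})$ be a primal-dual pair of semidefinite optimization problems with $m$ equality constraints, $n\times n$ symmetric matrices and integer data $A^1,\dots,A^m,C,b$, such that $A^1,\dots,A^m$ are linearly independent and there is a feasible $(X^\circ,y^\circ,S^\circ)$ with $X^\circ\succ 0$ and $S^\circ\succ 0$. Let $\phi:(0,\infty)\to\mathbb{R}^{\bar n}$, $\bar n=m+n(n+1)$, be the central path. Then, when $\mu>0$ is sufficiently small, the degree of the Zariski closure of the central path restricted to $(0,\mu]$, i.e. of $\phi((0,\mu])$, is bounded above by $2^{O(m+n^2)}$. Explicitly: there is an absolute constant $c>0$ such that for every such problem there is $\mu_0>0$ (depending on the problem) such that for all $0<\mu\le\mu_0$ the degree of the Zariski closure of $\phi((0,\mu])$ is at most $2^{c(m+n^2)}$.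
   Context: Let $\mathbb{S}^n$ be the space of real symmetric $n\times n$ matrices with inner product $\langle X,S\rangle=\operatorname{trace}(XS)$. $X\succeq 0$ (resp. $X\succ0$) means positive semidefinite (resp. positive definite). Given $C,A^1,\dots,A^m\in\mathbb{S}^n$ and $b\in\mathbb{R}^m$, all with integer entries, the problems are $$(\mathrm{P})\quad \inf_{X\in\mathbb{S}^n}\{\langle C,X\rangle : \langle A^i,X\rangle=b_i,\ i=1,\dots,m,\ X\succeq0\},$$ $$(\mathrm{D})\quad \sup_{(y,S)\in\mathbb{R}^m\times\mathbb{S}^n}\{b^Ty : \textstyle\sum_{i=1}^m y_iA^i+S=C,\ S\succeq 0\}.$$ A triple $(X,y,S)$ is feasible if it satisfies all constraints of $(\mathrm{P})$ and $(\mathrm{D})$. Central path: under the assumptions in the claim, for each $\mu>0$ there is a unique triple $(X(\mu),y(\mu),S(\mu))$ satisfying $$\langle A^i,X\rangle=b_i\ (i=1,\dots,m),\quad \sum_{i=1}^m y_iA^i+S=C,\quad XS=\mu I_n,\quad X,S\succ0.$$ A symmetric matrix $X$ is identified with the vector $x=(X_{11},X_{12},\dots,X_{1n},X_{22},\dots,X_{nn})^T$ of its $t(n)=\binom{n+1}{2}$ upper triangular entries, and $\phi(\mu)=(x(\mu);y(\mu);s(\mu))\in\mathbb{R}^{t(n)}\times\mathbb{R}^m\times\mathbb{R}^{t(n)}=\mathbb{R}^{\bar n}$, with $\bar n=m+2t(n)$, where $x(\mu),s(\mu)$ are the vectors of $X(\mu),S(\mu)$. The degree of the Zariski closure (an algebraic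 curve) is its usual degree as an affine variety, i.e. the number of points in which its Zariski closure (over $\mathbb{C}$) meets a generic affine hyperplane $a_0+a_1V_1+\dots+a_{\bar n}V_{\bar n}=0$. *)

(* Defs.v *)
From mathcomp Require Import all_boot all_order all_algebra.
From mathcomp Require Import classical_sets cardinality reals.
From mathcomp Require Import mpoly.

Set Implicit Arguments.
Unset Strict Implicit.
Unset Printing Implicit Defensive.

Import Order.TTheory GRing.Theory Num.Theory.
Local Open Scope classical_set_scope.
Local Open Scope card_scope.
Local Open Scope ring_scope.

Definition psdmx (R : numDomainType) (n : nat) (X : 'M[R]_n) : Prop :=
  X^T = X /\ forall v : 'cV[R]_n, 0 <= (v^T *m X *m v) 0 0.

Definition pdmx (R : numDomainType) (n : nat) (X : 'M[R]_n) : Prop :=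
  X^T = X /\ forall v : 'cV[R]_n, v != 0 -> 0 < (v^T *m X *m v) 0 0.

Definition primal_eqs (R : numDomainType) (m n : nat)
    (A : 'I_m -> 'M[R]_n) (b : 'rV[R]_m) (X : 'M[R]_n) : Prop :=
  forall i, \tr (A i *m X) = b 0 i.

Definition dual_eqs (R : numDomainType) (m n : nat)
    (A : 'I_m -> 'M[R]_n) (C : 'M[R]_n) (y : 'rV[R]_m) (S : 'M[R]_n) : Prop :=
  \sum_(i < m) y 0 i *: A i + S = C.

Definition feasible (R : numDomainType) (m n : nat)
    (A : 'I_m -> 'M[R]_n) (b : 'rV[R]_m) (C : 'M[R]_n)
    (X : 'M[R]_n) (y : 'rV[R]_m) (S : 'M[R]_n) : Prop :=
  [/\ primal_eqs A b X, psdmx X, dual_eqs A C y S & psdmx S].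

Definition central (R : numDomainType) (m n : nat)
    (A : 'I_m -> 'M[R]_n) (b : 'rV[R]_m) (C : 'M[R]_n) (mu : R)
    (X : 'M[R]_n) (y : 'rV[R]_m) (S : 'M[R]_n) : Prop :=
  [/\ primal_eqs A b X, dual_eqs A C y S, X *m S = mu%:M, pdmx X & pdmx S].

Definition triu (n : nat) := [pred p : 'I_n * 'I_n | (p.1 <= p.2)%N].

Lemma card_triu (n : nat) : #|triu n| = 'C(n.+1, 2).
Proof.
rewrite -sum1_card -bin2_sum big_nat_recl // add0n big_mkord.
rewrite -(pair_big_dep predT (fun i j : 'I_n => (i <= j)%N)
  (fun _ _ => 1%N)) /=.
rewrite (exchange_big_dep predT) //=; apply: eq_bigr => j _.
by rewrite -(big_ord_widen n (fun _ => 1%N) (ltn_ord j)) sum1_card card_ord.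
Qed.

(* [enum_val] lists the pairs i <= j in lexicographic order, i.e. the entries
   in the order X11, X12, ..., X1n, X22, ..., Xnn. *)
Definition svec (R : Type) (n : nat) (X : 'M[R]_n) : 'rV[R]_('C(n.+1, 2)) :=
  \row_k (let p := enum_val (cast_ord (esym (card_triu n)) k) in X p.1 p.2).

Definition pd_dim (m n : nat) : nat := 'C(n.+1, 2) + (m + 'C(n.+1, 2)).

Lemma pd_dimE (m n : nat) : pd_dim m n = (m + n * n.+1)%N.
Proof. by rewrite /pd_dim addnCA addnn bin2 mulnC halfK oddM oddS andbN subn0. Qed.

Definition pd_vec (R : Type) (m n : nat)
    (X : 'M[R]_n) (y : 'rV[R]_m) (S : 'M[R]_n) : 'rV[R]_(pd_dim m n) :=
  row_mx (svec X) (row_mx y (svec S)).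

(* The default value 0 of [xget] is not reached for mu > 0 when the A i are
   linearly independent and a strictly feasible triple exists: the central
   triple then exists and is unique. *)
Definition central_path (R : realType) (m n : nat)
    (A : 'I_m -> 'M[R]_n) (b : 'rV[R]_m) (C : 'M[R]_n)
    (mu : R) : 'rV[R]_(pd_dim m n) :=
  let t :=
    xget (0, 0, 0)
      [set t : 'M[R]_n * 'rV[R]_m * 'M[R]_n
         | central A b C mu t.1.1 t.1.2 t.2] in
  pd_vec t.1.1 t.1.2 t.2.

Definition zariski_closure (F : fieldType) (N : nat) (K : set 'rV[F]_N) :
    set 'rV[F]_N :=
  [set z | forall p : {mpoly F[N]},
     (forall v, K v -> p.@[fun i => v 0 i] = 0) -> p.@[fun i => z 0 i] = 0].

Definition hyperplane (F : fieldType) (N : nat) (a : 'rV[F]_N.+1) :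
    set 'rV[F]_N :=
  [set z | a 0 ord0 + \sum_(i < N) a 0 (lift ord0 i) * z 0 i = 0].

(* "Generic" means: off the zero locus of some nonzero polynomial in the
   coefficients of the hyperplane. For an algebraic curve over an algebraically
   closed field this is the usual degree. *)
Definition has_degree (F : fieldType) (N : nat) (Z : set 'rV[F]_N)
    (d : nat) : Prop :=
  exists2 q : {mpoly F[N.+1]}, q != 0 &
    forall a : 'rV[F]_N.+1, q.@[fun i => a 0 i] != 0 ->
      Z `&` hyperplane a #= `I_d.

(* Main.v *)
From HB Require Import structures.
Require Import Defs.
From mathcomp Require Import all_boot all_order all_algebra.
From mathcomp Require Import boolp classical_sets cardinality reals complex.
From mathcomp Require Import mpoly closed_field generic_quotient zify ring.

(** The points of the path solve a square system.  Put N := pd_dim m n, and let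
    G_1 = t e_1, ..., G_N = t e_N be the equations of the central path at the
    parameter t with the centrality condition symmetrised to X S + S X = 2 t I.
    These are N equations of degree at most 2 in the N coordinates of
    (X, y, S), and at a central triple their Jacobian is invertible
    ([kkt_diff_central_eq0]).

    Perturb the system to G_i + eps V_i^3 = t e_i with a formal parameter eps.
    Two facts about the perturbed system bound the Hilbert function of the path.
    - Newton iteration lifts every central triple to a solution of the perturbed
      system modulo any power of eps ([kkt_lift]).
    - The cubes can be rewritten in terms of lower degree, so that eps^k P is, for
      each P of degree at most k, a combination of the 3^N monomials with
      exponents at most 2, the coefficients being polynomials of degree at most k
      in t ([reducible_of_degree]).
    Hence more than 3^N (k+1) polynomials of degree at most k satisfy a linear
    relation over the polynomials in eps, which can be chosen not to vanish at
    eps = 0; evaluated along the lifts at eps = 0 it becomes a linear relation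
    that holds at every point of the path ([independent_card_bound]).  One more
    dimension accounts for the value 0 which the path takes by convention where
    there is no central triple.

    The growth rate 3^N of this Hilbert function bounds hyperplane sections of
    the Zariski closure Z.  If an affine form l is not a zero divisor modulo the
    vanishing ideal and vanishes at M points of Z, then the products l^s g_i,
    where the g_i separate the M points, are linearly independent on Z, which
    forces M <= 3^N ([closure_section_bound]).  By Noetherian induction, l is not
    a zero divisor as soon as it is nonzero at finitely many well-chosen points,
    which is a generic condition on l ([ex_nonzerodivisor_points]).

    That a generic hyperplane meets Z in a number of points which does not depend
    on the hyperplane follows from quantifier elimination over an algebraically
    closed field: Z is the zero set of finitely many polynomials
    ([zariski_closure_finite]), so that having at least d points on the section
    is a first-order condition on the coefficients of the hyperplane, and it
    holds either generically or generically not ([generic_truth]).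

    Finally N = m + n (n + 1), so that 3^N <= 2^(4 (m + n^2)). *)

Set Implicit Arguments.
Unset Strict Implicit.
Unset Printing Implicit Defensive.

Import Order.TTheory GRing.Theory Num.Theory.
Local Open Scope classical_set_scope.
Local Open Scope ring_scope.

(** * Noetherian induction on sets of points *)

Local Notation "p .[: v ]" := (p.@[fun i => @fun_of_matrix _ 1 _ v 0 i])
  (at level 2, left associativity, format "p .[:  v ]") : ring_scope.

Definition vanishes (F : fieldType) (N : nat) (K : set 'rV[F]_N)
  (p : {mpoly F[N]}) : Prop := forall v, K v -> p.[: v] = 0.

(** Each next index is one where u is minimal among all later indices. *)
Lemma nat_nondecr_subseq (u : nat -> nat) : exists2 s : nat -> nat,
  (forall i j, (i < j)%N -> (s i < s j)%N) &
  (forall i j, (i <= j)%N -> (u (s i) <= u (s j))%N).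
Proof.
have argmin n : exists k, (n < k)%N /\ forall l, (n < l)%N -> (u k <= u l)%N.
  pose P v := `[< exists2 l, (n < l)%N & u l = v >].
  have exP : exists v, P v by exists (u n.+1); apply/asboolP; exists n.+1.
  case: (ex_minnP exP) => v /asboolP[k ltnk <-] minv.
  by exists k; split=> // l ltnl; apply: minv; apply/asboolP; exists l.
have {argmin} [f fP] := choice argmin.
pose s i := iter i.+1 f 0%N.
have sS i : (s i < s i.+1)%N by have [] := fP (s i).
have usS i : (u (s i) <= u (s i.+1))%N.
  have [lt1 min1] := fP (iter i f 0%N); apply: min1.
  exact: ltn_trans lt1 (sS i).
exists s.
  exact: (@homo_ltn _ s (fun a b => a < b)%N (fun b a c => @ltn_trans b a c) sS).
by apply: (@homo_leq _ s (fun a b => u a <= u b)%N _ _ usS) => // a b c; exact: leq_trans.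
Qed.

(** Passing to a subsequence along which one more coordinate is nondecreasing, once
    for each coordinate, makes all coordinates nondecreasing at once. *)
Lemma dickson (N : nat) (m : nat -> 'X_{1..N}) :
  exists i j, (i < j)%N /\ (m i <= m j)%MM.
Proof.
suff mono k : exists2 s : nat -> nat, (forall i j, (i < j)%N -> (s i < s j)%N) &
    forall c : 'I_N, (c < k)%N -> forall i j, (i <= j)%N -> (m (s i) c <= m (s j) c)%N.
  have [s sP mP] := mono N; exists (s 0%N), (s 1%N); split; first exact: sP.
  by apply/mnm_lepP => c; apply: mP.
elim: k => [|k [s sP mP]]; first by exists id.
have [ltkN|leNk] := ltnP k N; last first.
  by exists s => // c ltck; apply: mP; have := ltn_ord c; lia.
have [t tP utP] := nat_nondecr_subseq (fun i => m (s i) (Ordinal ltkN)).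
exists (s \o t) => [i j ltij|c]; first exact/sP/tP.
rewrite ltnS leq_eqVlt => /orP[/eqP eqck|ltck] i j leij /=.
  by have -> : c = Ordinal ltkN; [exact: val_inj | exact: utP].
apply: mP => //; move: leij; rewrite leq_eqVlt => /orP[/eqP->//|ltij].
exact/ltnW/tP.
Qed.

Lemma wf_minimal (T : Type) (r : T -> T -> Prop) (P : T -> Prop) :
  well_founded r -> (exists x, P x) -> exists2 x, P x & forall y, P y -> ~ r y x.
Proof.
move=> wfr [x Px]; apply: contrapT => nmin; move: Px.
elim/(well_founded_ind wfr): x => x IH Px; apply: nmin; exists x => // y Py ryx.
exact: IH ryx Py.
Qed.

(** Well-foundedness of strict inclusion between closed sets, in a form that speaks
    of point sets only: the induction step may assume the claim for any subset on
    which some new polynomial vanishes.  In a chain of counterexamples with strictly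
    growing vanishing ideals I_0, I_1, ..., choose g_n of least leading monomial
    in the union of the I_i but outside I_n.  By Dickson's lemma some leading monomial
    divides a later one; cancelling the later one gives a smaller element of the
    union outside the same ideal, a contradiction. *)
Lemma noetherian_ind (F : fieldType) (N : nat) (P : set 'rV[F]_N -> Prop) :
  (forall K, (forall K', K' `<=` K ->
      (exists2 p, vanishes K' p & ~ vanishes K p) -> P K') -> P K) ->
  forall K, P K.
Proof.
move=> IH K0; apply: contrapT => nPK0.
have next (K : {K | ~ P K}) : exists K' : {K | ~ P K}, sval K' `<=` sval K /\
    exists2 p, vanishes (sval K') p & ~ vanishes (sval K) p.
  case: K => K nPK /=; apply: contrapT => nex; apply: nPK; apply: IH => K' sK' pK'.
  by apply: contrapT => nPK'; apply: nex; exists (exist _ K' nPK').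
have {next} [f fP] := choice next.
pose C n := sval (iter n f (exist _ K0 nPK0)).
have C_anti i j : (i <= j)%N -> C j `<=` C i.
  move=> leij; rewrite -(subnK leij); elim: (j - i)%N => //= d IHd.
  by apply: subset_trans IHd; have [] := fP (iter (d + i) f (exist _ K0 nPK0)).
(* J is the union of the vanishing ideals of the chain. *)
pose J p := exists n, vanishes (C n) p.
have J_min n : exists p, [/\ J p, ~ vanishes (C n) p & forall q, J q ->
    ~ vanishes (C n) q -> ~ (mlead q < mlead p)%O].
  pose Q mu := exists p, [/\ J p, ~ vanishes (C n) p & mlead p = mu].
  have exQ : exists mu, Q mu.
    have [_ [p pS np]] := fP (iter n f (exist _ K0 nPK0)).
    by exists (mlead p), p; split=> //; exists n.+1.
  have [_ [p [Jp np <-]] minp] := wf_minimal (@ltom_wf N) exQ.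
  by exists p; split=> // q Jq nq; apply: minp; exists q.
have {J_min} [g gP] := choice J_min.
have later n : exists r, (n < r)%N /\ vanishes (C r) (g n).
  have [[k gk] _ _] := gP n; exists (maxn k n.+1); split; first by lia.
  by move=> v Cv; apply: gk; apply: C_anti Cv; exact: leq_maxl.
have {later} [r rP] := choice later.
(* Along idx, each chosen polynomial lies in the ideal of the next index. *)
pose idx i := iter i r 0%N.
have idxP i j : (i < j)%N -> (r (idx i) <= idx j)%N.
  move=> ltij; rewrite -(subnK ltij); elim: (j - i.+1)%N => //= d IHd.
  by apply: leq_trans IHd _; have [/ltnW] := rP (idx (d + i.+1)%N).
have [i [j [ltij lemm]]] := dickson (fun i => mlead (g (idx i))).
have gi_van : vanishes (C (idx j)) (g (idx i)).
  by move=> v Cv; have [_] := rP (idx i); apply; apply: C_anti Cv; exact: idxP.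
have [Jgj ngj minj] := gP (idx j).
have nz n : g n != 0.
  by have [_ ng _] := gP n; apply: contra_notN ng => /eqP-> v _; rewrite meval0.
set gi := g (idx i) in lemm gi_van; set gj := g (idx j) in lemm ngj minj Jgj.
set d := (mlead gj - mlead gi)%MM.
pose c := mleadc gj / mleadc gi.
pose h := gj - c *: ('X_[d] * gi).
have ld_q : mlead ('X_[d] * gi) = mlead gj.
  rewrite mleadM ?nz ?mleadXm ?submK //.
  by rewrite -msupp_eq0 msuppX.
have h_van : vanishes (C (idx j)) h -> False.
  move=> hv; apply: ngj => v Cv; have := hv v Cv.
  by rewrite mevalB mevalZ mevalM gi_van // !mulr0 subr0.
apply: (minj h) => //.
  have [k gk] := Jgj; exists (maxn k (idx j)) => v Cv.
  rewrite mevalB mevalZ mevalM gi_van ?gk ?mulr0 ?subr0 //.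
    exact: C_anti (leq_maxl _ _) v Cv.
  exact: C_anti (leq_maxr _ _) v Cv.
have h0 : h != 0.
  by apply/negP => /eqP h0; apply: h_van => v _; rewrite h0 meval0.
have le_h : (mlead h <= mlead gj)%O.
  apply: le_trans (mleadB_le _ _) _; rewrite leUx lexx /=.
  by rewrite (le_trans (mleadZ_le _ _)) // ld_q.
rewrite lt_neqAle le_h andbT; apply/negP => /eqP eq_lead.
have : h@_(mlead h) = 0; last by move/eqP; rewrite mleadc_eq0 (negPf h0).
have coef_q : ('X_[d] * gi)@_(mlead gj) = mleadc gi.
  have -> : mlead gj = (mlead ('X_[F, d]) + mlead gi)%MM by rewrite mleadXm submK.
  by rewrite mleadcM mleadXm mcoeffX eqxx mul1r.
by rewrite eq_lead mcoeffB mcoeffZ coef_q divfK ?subrr // mleadc_eq0 nz.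
Qed.

(** If the vanishing ideal of K is prime, one point of K is enough, since a
    polynomial that is nonzero there is outside the ideal.  Otherwise K is the union
    of two smaller closed pieces, and the two finite lists can be concatenated. *)
Lemma ex_nonzerodivisor_points (F : fieldType) (N : nat) (K : set 'rV[F]_N) :
  exists2 vs : seq 'rV[F]_N, {in vs, forall v, K v} &
    forall f : {mpoly F[N]}, {in vs, forall v, f.[: v] != 0} ->
    forall g, vanishes K (f * g) -> vanishes K g.
Proof.
elim/noetherian_ind: K => K IH.
have [[p [q [pqK nKp nKq]]] | prime] := pselect (exists p q : {mpoly F[N]},
    [/\ vanishes K (p * q), ~ vanishes K p & ~ vanishes K q]).
  pose sub r := K `&` [set v | r.[: v] = 0].
  have IHr r : ~ vanishes K r -> exists2 vs : seq 'rV[F]_N, {in vs, forall v, sub r v} &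
      forall f : {mpoly F[N]}, {in vs, forall v, f.[: v] != 0} ->
      forall g, vanishes (sub r) (f * g) -> vanishes (sub r) g.
    by move=> nr; apply: IH => [v []//|]; exists r => // v [].
  have [vs vsP vsN] := IHr p nKp; have [ws wsP wsN] := IHr q nKq.
  exists (vs ++ ws) => [v | f fN g fgK v Kv].
    by rewrite mem_cat => /orP[/vsP[]|/wsP[]].
  have /eqP := pqK v Kv; rewrite mevalM mulf_eq0 => /orP[]/eqP z.
    by apply: (vsN f) => [w ws'| w [Kw _]|//];
      [apply: fN; rewrite mem_cat ws' | exact: fgK].
  by apply: (wsN f) => [w ws'| w [Kw _]|//];
    [apply: fN; rewrite mem_cat ws' orbT | exact: fgK].
have [[v0 Kv0] | nK] := pselect (exists v, K v); last first.
  by exists [::] => // f _ g _ v Kv; case: nK; exists v.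
exists [:: v0] => [v | f fN g fgK]; first by rewrite inE => /eqP->.
apply: contrapT => nKg; apply: prime; exists f, g; split=> // fK.
by have /negP := fN v0 (mem_head _ _); rewrite fK.
Qed.

(** A form of Hilbert's basis theorem: adding vanishing polynomials one at a time
    cuts the whole space down to the closure after finitely many steps. *)
Lemma zariski_closure_finite (F : fieldType) (N : nat) (K : set 'rV[F]_N) :
  exists ps : seq {mpoly F[N]},
    zariski_closure K = [set z | {in ps, forall p, p.[: z] = 0}].
Proof.
suff [ps psK psZ] : exists2 ps : seq {mpoly F[N]}, {in ps, forall p, vanishes K p} &
    setT `&` [set z | {in ps, forall p, p.[: z] = 0}] `<=` zariski_closure K.
  exists ps; apply/seteqP; split=> z.
    by move=> Zz p /psK; exact: Zz.
  by move=> z0; apply: psZ.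
elim/noetherian_ind: [set: 'rV[F]_N] => W IH.
have [WZ | nWZ] := pselect (W `<=` zariski_closure K).
  by exists [::] => // z [/WZ].
have [z [Wz [p [Kp npz]]]] : exists z, W z /\ exists p, vanishes K p /\ p.[: z] <> 0.
  apply: contrapT => nz; apply: nWZ => z Wz p Kp; apply: contrapT => npz.
  by apply: nz; exists z; split=> //; exists p.
have [||ps psK psW] := IH (W `&` [set v | p.[: v] = 0]).
- by move=> v [].
- by exists p => [v []|/(_ z Wz)].
exists (p :: ps) => [q|v [Wv vP]]; first by rewrite inE => /predU1P[->|/psK].
apply: psW; split; first by split=> //; apply: vP; exact: mem_head.
by move=> q qps; apply: vP; rewrite inE qps orbT.
Qed.

(** * Linear relations over polynomial rings *)

Lemma fraction_common_denom (R : idomainType) (h : nat) (u : 'rV[{fraction R}]_h) :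
  exists2 d : R, d != 0 &
    exists l : 'rV[R]_h, tofrac d *: u = map_mx (@tofrac R) l.
Proof.
have clear1 (x : {fraction R}) : exists2 d : R, d != 0 & exists a : R, tofrac d * x = tofrac a.
  elim/quotW: x => r; exists (\d_r); first exact: denom_ratioP.
  exists (\n_r); rewrite !piE; apply/eqmodP; rewrite /= FracField.equivfE /=.
  by rewrite !numden_Ratio ?mul1r ?oner_neq0 ?denom_ratioP // mulr1.
suff [d d0 dP] : exists2 d : R, d != 0 & forall j, exists a : R, tofrac d * u 0 j = tofrac a.
  have [l lP] := choice dP; exists d => //; exists (\row_j l j).
  by apply/rowP => j; rewrite !mxE lP.
have [e eP] := choice (fun j => let: ex_intro2 d d0 H := clear1 (u 0 j) in
   ex_intro (fun d => d != 0 /\ exists a : R, tofrac d * u 0 j = tofrac a) d (conj d0 H)).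
exists (\prod_j e j) => [|j].
  by apply/prodf_neq0 => j _; have [] := eP j.
have [_ [a ea]] := eP j.
exists (a * \prod_(i | i != j) e i).
by rewrite (bigD1 j) //= !tofracM mulrAC ea.
Qed.

(** A nonzero relation exists over the field of fractions; after clearing denominators,
    dividing by the largest common power of the variable keeps it nonzero at 0. *)
Lemma poly_left_kernel (F : fieldType) (h r : nat) (M : 'M[{poly F}]_(h, r)) :
  (r < h)%N ->
  exists2 l : 'rV[{poly F}]_h, l *m M = 0 & exists j, (l 0 j).[0] != 0.
Proof.
move=> ltrh.
have [l l0 lM] : exists2 l : 'rV[{poly F}]_h, l != 0 & l *m M = 0.
  pose M' := map_mx (@tofrac {poly F}) M.
  have /rowV0Pn [u /sub_kermxP uM u0] : kermx M' != 0.
    rewrite -mxrank_eq0 mxrank_ker subn_eq0 -ltnNge.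
    exact: leq_ltn_trans (rank_leq_col _) ltrh.
  have [d d0 [l ul]] := fraction_common_denom u; exists l.
    apply: contraNneq u0 => l0; move: ul; rewrite l0 map_mx0 => /eqP.
    by rewrite scaler_eq0 tofrac_eq0 (negPf d0).
  have inj : injective (@tofrac {poly F}).
    by move=> a b /eqP; rewrite tofrac_eq => /eqP.
  have : map_mx (@tofrac {poly F}) (l *m M) = 0 by rewrite map_mxM -ul -scalemxAl uM scaler0.
  move=> /rowP lM0; apply/rowP => j; apply: inj.
  by have := lM0 j; rewrite !mxE /= tofrac0.
have [n] : exists n, (\sum_j size (l ord0 j) < n)%N by exists (\sum_j size (l ord0 j)).+1.
elim: n => // n IH in l l0 lM *; rewrite ltnS => le_n.
have [[j lj] | all0] := pselect (exists j, (l 0 j).[0] != 0).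
  by exists l => //; exists j.
have {}all0 j : 'X %| l 0 j.
  rewrite -['X]subr0 -polyC0 dvdp_XsubCl; apply: contrapT => nr; apply: all0; exists j.
  by apply/negP.
pose l' := \row_j (l 0 j %/ 'X).
have ll' : l = 'X *: l' by apply/rowP => j; rewrite !mxE mulrC divpK.
have l'0 : l' != 0 by apply: contraNneq l0 => l'0; rewrite ll' l'0 scaler0.
apply: (IH l') => //.
  apply/matrixP => i j; have /matrixP/(_ i j)/eqP := lM.
  by rewrite ll' -scalemxAl !mxE mulf_eq0 polyX_eq0 => /eqP.
apply: leq_trans le_n.
have /rV0Pn [j0 l'j0] : l' != 0 by [].
have sz j : (size (l' ord0 j) + (l' ord0 j != 0%R) <= size (l ord0 j))%N.
  have [->|nz] := eqVneq (l' 0 j) 0; first by rewrite size_poly0.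
  by rewrite ll' [in leqRHS]mxE mulrC size_mulX // addn1.
rewrite (bigD1 j0) // [in leqRHS](bigD1 j0) //= -addSn leq_add //.
  by apply: leq_trans (sz j0); rewrite l'j0 addn1.
by apply: leq_sum => j _; apply: leq_trans (sz j); exact: leq_addr.
Qed.

(** * Normal forms for a cubic perturbation of a quadratic system *)

Lemma msizeM_leq (R : idomainType) (N : nat) (p q : {mpoly R[N]}) (a b : nat) :
  (msize p <= a.+1)%N -> (msize q <= b.+1)%N -> (msize (p * q) <= (a + b).+1)%N.
Proof.
have [->|p0] := eqVneq p 0; first by rewrite mul0r mmeasure0.
have [->|q0] := eqVneq q 0; first by rewrite mulr0 mmeasure0.
rewrite msizeM // => le_p le_q; rewrite -ltnS prednK.
  by rewrite -addSn -addnS leq_add.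
by rewrite addn_gt0 lt0n mmeasure_poly_eq0 p0.
Qed.

Lemma msizeD_leq (R : idomainType) (N k : nat) (p q : {mpoly R[N]}) :
  (msize p <= k)%N -> (msize q <= k)%N -> (msize (p + q) <= k)%N.
Proof. by move=> pk qk; apply: leq_trans (mmeasureD_le _ _ _) _; rewrite geq_max pk. Qed.

Lemma msize_sum_leq (R : idomainType) (N k : nat) (I : Type) (r : seq I)
    (p : I -> {mpoly R[N]}) :
  (forall i, msize (p i) <= k)%N -> (msize (\sum_(i <- r) p i) <= k)%N.
Proof.
move=> pk; apply: (big_ind (fun q => msize q <= k)%N) => //.
- by rewrite mmeasure0.
- exact: msizeD_leq.
Qed.

Section CubicPerturbation.
Variables (F : fieldType) (N : nat) (G : 'I_N -> {mpoly F[N]}) (e : 'I_N -> F).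
Hypothesis G_quadratic : forall i, (msize (G i) <= 3)%N.

(** The value of p at a point with coordinates in F[eps], with eps written 'X. *)
Definition eval_eps (w : 'rV[{poly F}]_N) (p : {mpoly F[N]}) : {poly F} :=
  mmap polyC (fun i => w 0 i) p.

(** A solution modulo eps^j of the perturbed system G_i + eps V_i^3 = t e_i. *)
Definition cubic_solution (t : F) (j : nat) (w : 'rV[{poly F}]_N) : Prop :=
  forall i, 'X^j %| eval_eps w (G i) - (t * e i)%:P + 'X * w 0 i ^+ 3.

Definition small_monomial (w : 'rV[{poly F}]_N) (al : {ffun 'I_N -> 'I_3}) : {poly F} :=
  \prod_i w 0 i ^+ al i.

(** A normal form of eps^k p that is correct only on the solutions of the perturbed
    system.  The coefficients are polynomials in t with coefficients in F[eps]; they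
    do not depend on the solution or on its precision j. *)
Definition reducible (k : nat) (p : {mpoly F[N]}) : Prop :=
  exists c : {ffun 'I_N -> 'I_3} -> {poly {poly F}},
    (forall al, size (c al) <= k.+1)%N /\
    forall t j w, cubic_solution t j w ->
      'X^j %| 'X^k * eval_eps w p - \sum_al (c al).[t%:P] * small_monomial w al.

Lemma reducibleD k p q : reducible k p -> reducible k q -> reducible k (p + q).
Proof.
move=> [c [cs cP]] [d [ds dP]]; exists (fun al => c al + d al); split=> [al | t j w sw].
  by apply: leq_trans (size_polyD _ _) _; rewrite geq_max cs ds.
under eq_bigr do rewrite hornerD mulrDl.
rewrite big_split /= opprD /eval_eps mmapD mulrDr addrACA.
exact: dvdp_add (cP _ _ _ sw) (dP _ _ _ sw).
Qed.

Lemma reducibleZ k a p : reducible k p -> reducible k (a *: p).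
Proof.
move=> [c [cs cP]]; exists (fun al => a%:P *: c al); split=> [al | t j w sw].
  by apply: leq_trans (cs al); exact: size_scale_leq.
under eq_bigr do rewrite hornerZ -mulrA.
rewrite -mulr_sumr /eval_eps mmapZ mulrCA -mulrBr.
exact: dvdp_mull (cP _ _ _ sw).
Qed.

Lemma reducible_sum k (I : eqType) (s : seq I) (p : I -> {mpoly F[N]}) :
  {in s, forall i, reducible k (p i)} -> reducible k (\sum_(i <- s) p i).
Proof.
move=> ps; rewrite big_seq; apply: (big_ind (reducible k)) => //.
- exists (fun _ => 0); split=> [al|t j w _]; first by rewrite size_poly0.
  rewrite /eval_eps mmap0 mulr0 big1 ?subrr ?dvdp0 // => al _.
  by rewrite horner0 mul0r.
- exact: reducibleD.
Qed.

Lemma small_reducible k (m : 'X_{1..N}) : (forall i, m i < 3)%N -> reducible k 'X_[m].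
Proof.
move=> m3; pose al0 := [ffun i => inord (m i)] : {ffun 'I_N -> 'I_3}.
exists (fun al => if al == al0 then ('X^k)%:P else 0); split=> [al | t j w _].
  by case: ifP => _; rewrite ?size_poly0 // (leq_trans (size_polyC_leq1 _)).
rewrite (bigD1 al0) //= eqxx hornerC big1 => [|al /negPf->]; last first.
  by rewrite horner0 mul0r.
rewrite /eval_eps mmapX addr0 (_ : mmap1 _ _ = small_monomial w al0) ?subrr ?dvdp0 //.
by apply: eq_bigr => i _; rewrite ffunE inordK.
Qed.

(** A monomial divisible by V_i^3 is rewritten with eps V_i^3 = t e_i - G_i: the
    total degree drops by at least 1, since G_i is quadratic, the exponent of t
    grows by at most 1, and one factor eps is used. *)
Lemma reducible_of_degree k p : (msize p <= k.+1)%N -> reducible k p.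
Proof.
have lin l : (forall m : 'X_{1..N}, (mdeg m <= l)%N -> reducible l 'X_[m]) ->
    forall q, (msize q <= l.+1)%N -> reducible l q.
  move=> mono q le_q; rewrite [q]mpolyE; apply: reducible_sum => m mq.
  by apply/reducibleZ/mono; rewrite -ltnS; apply: leq_trans le_q; exact: msize_mdeg_lt.
elim: k p => [|k IH]; apply: lin => m le_m.
  apply: small_reducible => i; move: le_m; rewrite leqn0 mdeg_eq0 => /eqP->.
  by rewrite mnm0E.
have [[i mi] | no3] := pselect (exists i, (2 < m i)%N); last first.
  by apply: small_reducible => i; rewrite ltnNge; apply/negP => mi; apply: no3; exists i.
pose d := (m - U_(i) *+ 3)%MM.
have le3 : (U_(i) *+ 3 <= m)%MM.
  apply/mnm_lepP => j; rewrite mulmnE mnm1E.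
  by case: eqVneq => [<-|]; rewrite ?mul1n // mul0n.
have md : m = (d + U_(i) *+ 3)%MM by rewrite submK.
have deg_d : (mdeg d + 3 <= k.+1)%N by move: le_m; rewrite md mdegD mdegMn mdeg1.
have [c [cs cP]] : reducible k 'X_[d] by apply: IH; rewrite msizeX; lia.
have [c' [cs' cP']] : reducible k (G i * 'X_[d]).
  apply: IH; apply: leq_trans (msizeM_leq (b := mdeg d) (G_quadratic i) _) _.
    by rewrite msizeX.
  by lia.
exists (fun al => ((e i)%:P%:P * 'X) * c al - c' al); split=> [al|t j w sw].
  apply: leq_trans (size_polyD _ _) _; rewrite geq_max size_polyN.
  rewrite (leq_trans (cs' al)) // andbT.
  rewrite -mulrA mul_polyC; apply: leq_trans (size_scale_leq _ _) _.
  by rewrite mulrC; apply: leq_trans (size_polyMleq _ _) _; rewrite size_polyX addn2 /= ltnS.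
have evm : eval_eps w 'X_[m] = eval_eps w 'X_[d] * w 0 i ^+ 3.
  rewrite {1}md mpolyXD /eval_eps rmorphM; congr (_ * _).
  by rewrite -mpolyXn rmorphXn /= mmapX mmap1U.
have evG : eval_eps w (G i * 'X_[d]) = eval_eps w (G i) * eval_eps w 'X_[d].
  by rewrite /eval_eps rmorphM.
under eq_bigr do rewrite hornerD hornerN !hornerM !hornerC hornerX mulrBl -!mulrA.
rewrite sumrB -!mulr_sumr.
have := dvdp_mull ('X^k * eval_eps w 'X_[d]) (sw i).
move=> /dvdp_add/(_ (dvdp_mull ((t * e i)%:P) (cP _ _ _ sw))).
move=> /dvdp_sub/(_ (cP' _ _ _ sw)).
congr (_ %| _); rewrite evm evG (exprS _ k) polyCM.
set A := \sum__ _; set B := \sum__ _.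
ring.
Qed.
End CubicPerturbation.

(** * From the Hilbert function to hyperplane sections *)

(** Linear independence modulo the vanishing ideal of K. *)
Definition independent_on (F : fieldType) (N : nat) (K : set 'rV[F]_N) (I : finType)
    (p : I -> {mpoly F[N]}) : Prop :=
  forall c : I -> F, vanishes K (\sum_i c i *: p i) -> forall i, c i = 0.

Lemma eval_eps_at0 (F : fieldType) (N : nat) (w : 'rV[{poly F}]_N) (p : {mpoly F[N]}) :
  (eval_eps w p).[0] = p.[: map_mx (horner_eval 0) w].
Proof.
rewrite mevalE /eval_eps /mmap horner_sum; apply: eq_bigr => m _.
rewrite hornerM hornerC horner_prod; congr (_ * _); apply: eq_bigr => i _.
by rewrite mxE horner_exp.
Qed.

(** An upper bound for the Hilbert function of K at k.  The hypothesis on K asks that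
    each point, apart from an exceptional one z0, lifts to solutions of the cubic
    perturbation of arbitrary precision.  Coefficients of normal forms and the value
    at z0 give 3^N (k+1) + 1 linear functionals over F[eps], so a longer family
    has a relation among its normal forms, and its value at eps = 0 is a relation on K. *)
Lemma independent_card_bound (F : fieldType) (N : nat) (G : 'I_N -> {mpoly F[N]})
    (e : 'I_N -> F) (K : set 'rV[F]_N) (z0 : 'rV[F]_N) :
  (forall i, (msize (G i) <= 3)%N) ->
  (forall v, K v -> v = z0 \/ exists t, forall j, exists2 w : 'rV[{poly F}]_N,
      map_mx (horner_eval 0) w = v & cubic_solution G e t j w) ->
  forall k (I : finType) (p : I -> {mpoly F[N]}),
  (forall i, (msize (p i) <= k.+1)%N) -> independent_on K p ->
  (#|I| <= 3 ^ N * k.+1 + 1)%N.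
Proof.
move=> G2 Klift k I p p_deg p_ind; rewrite leqNgt; apply/negP => ltI.
have [c cP] := choice (fun i => reducible_of_degree e G2 (p_deg i)).
pose T := option ({ffun 'I_N -> 'I_3} * 'I_k.+1)%type.
have cardT : #|{: T}| = (3 ^ N * k.+1 + 1)%N.
  by rewrite card_option card_prod card_ffun !card_ord addn1.
pose M := \matrix_(i < #|I|, a < #|{: T}|)
  (if enum_val a is Some b then (c (enum_val i) b.1)`_b.2
   else ((p (enum_val i)).[: z0])%:P).
have [|l lM [i0 li0]] := poly_left_kernel M; first by rewrite cardT.
pose r i := l 0 (enum_rank i).
have rM (a : T) : \sum_i r i * (if a is Some b then (c i b.1)`_b.2 else (p i).[: z0]%:P) = 0.
  have /rowP/(_ (enum_rank a)) := lM; rewrite !mxE => lM0; rewrite -[RHS]lM0.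
  rewrite (reindex (@enum_val I predT)) /=; last by apply: onW_bij; exact: enum_val_bij.
  by apply: eq_bigr => i _; rewrite !mxE enum_rankK /r enum_valK.
case/negP: li0; apply/eqP.
have := p_ind (fun i => (r i).[0]) _ (enum_val i0); rewrite /r enum_valK; apply => v Kv.
rewrite raddf_sum /=; under eq_bigr do rewrite mevalZ.
have [->|[t /(_ k.+1) [w <- sw]]] := Klift v Kv.
  have := congr1 (horner^~ 0) (rM None); rewrite horner0 horner_sum => rM0; rewrite -[RHS]rM0.
  by apply: eq_bigr => i _; rewrite hornerM hornerC.
under eq_bigr do rewrite -eval_eps_at0 -hornerM.
rewrite -horner_sum; apply/eqP; rewrite -/(root _ _) -dvdp_XsubCl subr0.
(* Divisibility by 'X is proved after multiplication by 'X^k, as normal forms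
   describe only these multiples. *)
rewrite -(dvdp_mul2l (r := 'X^k)) ?expf_neq0 ?polyX_eq0 // -exprSr.
have combo : \sum_i r i * (\sum_al (c i al).[t%:P] * small_monomial w al) = 0.
  under eq_bigr do rewrite mulr_sumr.
  rewrite exchange_big big1 //= => al _.
  under eq_bigr => i _.
    have [cs _] := cP i; rewrite (horner_coef_wide _ (cs al)) mulrA mulr_sumr.
    over.
  rewrite -mulr_suml exchange_big big1 ?mul0r //= => b _.
  under eq_bigr do rewrite mulrA.
  by rewrite -mulr_suml (rM (Some (al, b))) mul0r.
rewrite -[X in _ %| X]subr0 -[X in _ - X]combo mulr_sumr -sumrB.
apply: (big_ind (fun q => 'X^(k.+1) %| q)) => [||i _]; [exact: dvdp0 | exact: dvdp_add |].
rewrite mulrCA -mulrBr; apply: dvdp_mull.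
by have [_] := cP i; apply.
Qed.

Lemma lagrange_mpoly (F : fieldType) (N M : nat) (u : 'I_M -> 'rV[F]_N) : injective u ->
  exists g : 'I_M -> {mpoly F[N]}, forall i j, (g i).[: u j] = (i == j)%:R.
Proof.
move=> u_inj.
have sep i j : exists q : {mpoly F[N]}, j != i -> q.[: u i] = 1 /\ q.[: u j] = 0.
  have [->|neq] := eqVneq j i; first by exists 0.
  have /eqP/rowP/existsNP [c /eqP uc] : u i != u j.
    by apply: contra neq => /eqP/u_inj->.
  exists ((u i 0 c - u j 0 c)^-1 *: ('X_c - (u j 0 c)%:MP)) => _.
  rewrite !mevalZ !mevalB !mevalXU !mevalC subrr mulr0 mulVf // subr_eq0 //.
have [q qP] := choice (fun ij => sep ij.1 ij.2).
exists (fun i => \prod_(j | j != i) q (i, j)) => i j; rewrite rmorph_prod /=.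
have [<-|neq] := eqVneq i j.
  by apply: big1 => k ki; have [] := qP (i, k) ki.
rewrite (bigD1 j) /=; last by rewrite eq_sym.
by have [|_ ->] := qP (i, j); rewrite /= 1?eq_sym // mul0r.
Qed.

(** The products l^s g_i with s < T are independent on K: a relation among them,
    evaluated at the points u_j, where l vanishes, kills the terms with s = 0,
    and the remaining relation can be divided by l.  There are M T of them, of degree at
    most T + E for a constant E, so D is at least M when T is large. *)
Lemma closure_section_bound (F : fieldType) (N : nat) (K : set 'rV[F]_N) (D D' : nat)
    (l : {mpoly F[N]}) (M : nat) (u : 'I_M -> 'rV[F]_N) :
  (forall k (I : finType) (p : I -> {mpoly F[N]}),
     (forall i, (msize (p i) <= k.+1)%N) -> independent_on K p ->
     (#|I| <= D * k.+1 + D')%N) ->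
  (msize l <= 2)%N ->
  (forall g, vanishes K (l * g) -> vanishes K g) ->
  injective u -> (forall i, zariski_closure K (u i)) -> (forall i, l.[: u i] = 0) ->
  (M <= D)%N.
Proof.
move=> bound l_deg l_reg u_inj uK lu.
have [g gP] := lagrange_mpoly u_inj.
have free T (c : 'I_M -> nat -> F) :
    vanishes K (\sum_(s < T) \sum_i c i s *: (l ^+ s * g i)) ->
    forall i s, (s < T)%N -> c i s = 0.
  elim: T c => // T IH c cK.
  have c0 i : c i 0%N = 0.
    have := uK i _ cK; rewrite big_ord_recl /= mevalD !raddf_sum /=.
    rewrite (bigD1 i) //= big1 => [|j /negPf ji]; last first.
      by rewrite mevalZ mevalM gP ji !mulr0.
    rewrite big1 => [|s _].
      by rewrite !addr0 mevalZ mevalM expr0 meval1 gP eqxx !mulr1.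
    rewrite raddf_sum big1 //= => j _.
    by rewrite mevalZ mevalM exprS mevalM lu !mul0r mulr0.
  move=> i [//|s]; rewrite ltnS => ltsT; apply: (IH (fun i s => c i s.+1)) => //.
  apply: l_reg; move: cK; rewrite big_ord_recl big1 ?add0r => [|j _]; last first.
    by rewrite c0 scale0r.
  congr vanishes; rewrite mulr_sumr; apply: eq_bigr => s' _.
  rewrite mulr_sumr; apply: eq_bigr => j _.
  by rewrite -scalerAr exprS mulrA.
pose E := \max_i msize (g i).
have le_pow s : (msize (l ^+ s) <= s.+1)%N.
  elim: s => [|s IH]; first by rewrite expr0 msize1.
  by rewrite exprS; exact: (msizeM_leq (a := 1)).
rewrite leqNgt; apply/negP => ltDM.
(* The least T with D * (T + E).+1 + D' < D.+1 * T. *)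
pose T := (D * E.+1 + D').+1.
have := bound (T + E)%N ('I_M * 'I_T)%type (fun a => l ^+ a.2 * g a.1) _ _.
have le_bound : (D * (T + E).+1 + D' < M * T)%N by rewrite /T; nia.
rewrite card_prod !card_ord => le; have : (M * T <= D * (T + E).+1 + D')%N; last by lia.
apply: le => [[i s]|c cK [i s]] /=.
  have le_g : (msize (g i) <= E.+1)%N by apply: leqW; exact: leq_bigmax.
  apply: leq_trans (msizeM_leq (le_pow s) le_g) _.
  by have := ltn_ord s; lia.
have := free T (fun i s => if insub s is Some s' then c (i, s') else 0) _ i s (ltn_ord s).
rewrite valK; apply; move: cK; congr vanishes.
under [RHS]eq_bigr do under eq_bigr do rewrite valK.
by rewrite exchange_big pair_big /=; apply: eq_bigr => -[].
Qed.

(** * Generic hyperplanes and quantifier elimination *)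

Section Definability.
Variable F : closedFieldType.

Definition polynomial_in_env (g : seq F -> F) : Prop :=
  exists2 t : GRing.term F, GRing.rterm t & forall e, GRing.eval e t = g e.

Definition definable (P : seq F -> Prop) : Prop :=
  exists2 f : GRing.formula F, GRing.rformula f & forall e, GRing.holds e f <-> P e.

Lemma polynomial_var k : polynomial_in_env (fun e => e`_k).
Proof. by exists (GRing.Var F k). Qed.

Lemma polynomial_const c : polynomial_in_env (fun=> c).
Proof. by exists (GRing.Const c). Qed.

Lemma polynomial_add g h : polynomial_in_env g -> polynomial_in_env h ->
  polynomial_in_env (fun e => g e + h e).
Proof.
by move=> [t rt tP] [s rs sP]; exists (GRing.Add t s) => [|e] /=; rewrite ?rt ?tP ?sP.
Qed.

Lemma polynomial_mul g h : polynomial_in_env g -> polynomial_in_env h ->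
  polynomial_in_env (fun e => g e * h e).
Proof.
by move=> [t rt tP] [s rs sP]; exists (GRing.Mul t s) => [|e] /=; rewrite ?rt ?tP ?sP.
Qed.

Lemma polynomial_exp g n : polynomial_in_env g -> polynomial_in_env (fun e => g e ^+ n).
Proof. by move=> [t rt tP]; exists (GRing.Exp t n) => [|e] /=; rewrite ?tP. Qed.

Lemma polynomial_sum (I : Type) (s : seq I) (g : I -> seq F -> F) :
  (forall i, polynomial_in_env (g i)) -> polynomial_in_env (fun e => \sum_(i <- s) g i e).
Proof.
move=> gP; elim: s => [|i s [t rt tP]].
  by exists (GRing.Const 0) => // e; rewrite big_nil.
have [u ru uP] := gP i.
by exists (GRing.Add u t) => [|e] /=; rewrite ?ru // big_cons uP tP.
Qed.

Lemma polynomial_prod (I : Type) (s : seq I) (g : I -> seq F -> F) :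
  (forall i, polynomial_in_env (g i)) -> polynomial_in_env (fun e => \prod_(i <- s) g i e).
Proof.
move=> gP; elim: s => [|i s [t rt tP]].
  by exists (GRing.Const 1) => // e; rewrite big_nil.
have [u ru uP] := gP i.
by exists (GRing.Mul u t) => [|e] /=; rewrite ?ru // big_cons uP tP.
Qed.

Lemma polynomial_meval (N : nat) (p : {mpoly F[N]}) (v : 'I_N -> seq F -> F) :
  (forall i, polynomial_in_env (v i)) -> polynomial_in_env (fun e => p.@[fun i => v i e]).
Proof.
move=> vP; have [t rt tP] : polynomial_in_env
    (fun e => \sum_(m <- msupp p) p@_m * \prod_i v i e ^+ m i).
  apply: polynomial_sum => m; apply: polynomial_mul; first exact: polynomial_const.
  by apply: polynomial_prod => i; exact: polynomial_exp.
by exists t => // e; rewrite tP mevalE.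
Qed.

Lemma definable_eq0 g : polynomial_in_env g -> definable (fun e => g e = 0).
Proof.
by move=> [t rt tP]; exists (GRing.Equal t (GRing.Const 0)) => [|e] /=; rewrite ?rt ?tP.
Qed.

Lemma definable_and P Q : definable P -> definable Q -> definable (fun e => P e /\ Q e).
Proof.
move=> [f rf fP] [g rg gP]; exists (GRing.And f g) => [|e] /=; first by rewrite rf.
by rewrite fP gP.
Qed.

Lemma definable_not P : definable P -> definable (fun e => ~ P e).
Proof.
by move=> [f rf fP]; exists (GRing.Not f) => [|e] //=; rewrite fP.
Qed.

Lemma definable_forall (T : eqType) (s : seq T) (P : T -> seq F -> Prop) :
  (forall x, definable (P x)) -> definable (fun e => {in s, forall x, P x e}).
Proof.
move=> PP; elim: s => [|x s [f rf fP]].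
  by exists (GRing.Bool true) => // e; split.
have [g rg gP] := PP x; exists (GRing.And g f) => [|e] /=; first by rewrite rg.
rewrite gP fP; split=> [[Px Ps] y|all_s].
  by rewrite inE => /predU1P[->//|/Ps].
by split=> [|y ys]; apply: all_s; rewrite inE ?eqxx // ys orbT.
Qed.

Lemma definable_exists (I : seq nat) P : definable P ->
  definable (fun e => exists2 e', {in [predC I], GRing.same_env e e'} & P e').
Proof.
move=> [f rf fP]; exists (foldr GRing.Exists f I) => [|e]; first by elim: I.
rewrite -GRing.foldExistsP; split=> -[e' ee' h]; exists e' => //; exact/fP.
Qed.

Definition env (K : nat) (v : 'rV[F]_K) : seq F := [seq v 0 i | i <- enum 'I_K].

Lemma nth_env (K : nat) (v : 'rV[F]_K) (i : 'I_K) : (env v)`_i = v 0 i.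
Proof. by rewrite (nth_map i) ?size_enum_ord // nth_ord_enum. Qed.

(** After quantifier elimination the property is a boolean combination of equations
    between polynomials.  Off the zeros of the nontrivial equations, all atoms have
    a constant truth value. *)
Lemma generic_truth (K : nat) (P : seq F -> Prop) : definable P ->
  exists2 q : {mpoly F[K]}, q != 0 &
    forall a b, q.[: a] != 0 -> q.[: b] != 0 -> P (env a) -> P (env b).
Proof.
move=> [f0 rf0 f0P].
pose f := GRing.quantifier_elim (@ClosedFieldQE.ex_elim F) f0.
have /andP[qf rf] : GRing.qf_form f && GRing.rformula f.
  exact: GRing.quantifier_elim_wf (@ClosedFieldQE.wf_ex_elim F) _ rf0.
have fP e : reflect (P e) (GRing.qf_eval e f).
  apply: (iffP (GRing.quantifier_elim_rformP (@ClosedFieldQE.wf_ex_elim F)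
     (ClosedFieldQE.holds_ex_elim (@solve_monicpoly F)) e rf0)); by move/f0P.
have termP t : GRing.rterm t ->
    exists p : {mpoly F[K]}, forall a, GRing.eval (env a) t = p.[: a].
  elim: t => //=.
  - move=> k _; have [ltkK|leKk] := ltnP k K.
      by exists 'X_(Ordinal ltkK) => a; rewrite mevalXU -nth_env.
    by exists 0 => a; rewrite meval0 nth_default // size_map size_enum_ord.
  - by move=> c _; exists c%:MP => a; rewrite mevalC.
  - by move=> n _; exists n%:R%:MP => a; rewrite mevalC.
  - move=> t IHt u IHu /andP[/IHt[p pP] /IHu[q qP]].
    by exists (p + q) => a; rewrite mevalD pP qP.
  - by move=> t IHt /IHt[p pP]; exists (- p) => a; rewrite mevalN pP.
  - by move=> t IHt n /IHt[p pP]; exists (p *+ n) => a; rewrite mevalMn pP.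
  - move=> t IHt u IHu /andP[/IHt[p pP] /IHu[q qP]].
    by exists (p * q) => a; rewrite mevalM pP qP.
  - by move=> t IHt n /IHt[p pP]; exists (p ^+ n) => a; rewrite rmorphXn /= pP.
suff [q q0 [b qb]] : exists2 q : {mpoly F[K]}, q != 0 &
    exists b, forall a, q.[: a] != 0 -> GRing.qf_eval (env a) f = b.
  by exists q => // a a' qa qa' /fP Pa; apply/fP; rewrite qb // -(qb a).
elim: f qf rf {fP} => //=.
- by move=> b _ _; exists 1; [exact: oner_neq0 | exists b].
- move=> t u _ /andP[/termP[p pP] /termP[q qP]].
  have [pq|pq] := eqVneq p q.
    by exists 1; [exact: oner_neq0 | exists true => a _; rewrite pP qP pq eqxx].
  exists (p - q); first by rewrite subr_eq0.
  by exists false => a; rewrite mevalB subr_eq0 pP qP => /negPf.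
- move=> f IHf g IHg /andP[/IHf{}IHf /IHg{}IHg] /andP[/IHf[p p0 [b pb]] /IHg[q q0 [c qc]]].
  exists (p * q); first by rewrite mulf_neq0.
  by exists (b && c) => a; rewrite mevalM mulf_eq0 negb_or => /andP[/pb-> /qc->].
- move=> f IHf g IHg /andP[/IHf{}IHf /IHg{}IHg] /andP[/IHf[p p0 [b pb]] /IHg[q q0 [c qc]]].
  exists (p * q); first by rewrite mulf_neq0.
  by exists (b || c) => a; rewrite mevalM mulf_eq0 negb_or => /andP[/pb-> /qc->].
- move=> f IHf g IHg /andP[/IHf{}IHf /IHg{}IHg] /andP[/IHf[p p0 [b pb]] /IHg[q q0 [c qc]]].
  exists (p * q); first by rewrite mulf_neq0.
  by exists (b ==> c) => a; rewrite mevalM mulf_eq0 negb_or => /andP[/pb-> /qc->].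
- move=> f IHf /IHf{}IHf /IHf[p p0 [b pb]]; exists p => //.
  by exists (~~ b) => a /pb->.
Qed.

End Definability.

(** If a family of d distinct points of S cannot be extended by one more, it
    exhausts S. *)
Lemma card_eq_II_injective (T : choiceType) (S : set T) (d : nat) :
  (exists u : 'I_d -> T, injective u /\ forall i, S (u i)) ->
  ~ (exists u : 'I_d.+1 -> T, injective u /\ forall i, S (u i)) ->
  (S #= `I_d)%card.
Proof.
move=> [u [u_inj uS]] max.
have -> : S = range u.
  apply/seteqP; split=> [x Sx|_ [i _ <-]//]; apply: contrapT => nx.
  apply: max; exists (fun i => if unlift ord0 i is Some j then u j else x); split.
    move=> i j; case: unliftP => [i' ->|->]; case: unliftP => [j' ->|->] //.
    - by move/u_inj->.
    - by move=> ui; case: nx; exists i'.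
    - by move=> uj; case: nx; exists j'.
  by move=> i; case: unliftP.
by rewrite (card_eql (inj_card_eq (in2W u_inj))) card_eq_sym card_II.
Qed.

(** Off one hypersurface, for every d up to D + 1, whether a section has at least d points
    does not depend on the hyperplane; the degree is the largest d for which it does. *)
Lemma has_degree_of_section_bound (F : closedFieldType) (N : nat) (Z : set 'rV[F]_N)
    (ps : seq {mpoly F[N]}) (D : nat) (q0 : {mpoly F[N.+1]}) :
  Z = [set z | {in ps, forall p, p.[: z] = 0}] -> q0 != 0 ->
  (forall a, q0.[: a] != 0 -> forall M (u : 'I_M -> 'rV[F]_N), injective u ->
     (forall i, (Z `&` hyperplane a) (u i)) -> (M <= D)%N) ->
  exists2 d, has_degree Z d & (d <= D)%N.
Proof.
move=> ZE q0nz bound.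
pose E d (a : 'rV[F]_N.+1) := exists u : 'I_d -> 'rV[F]_N,
  injective u /\ forall i, (Z `&` hyperplane a) (u i).
have E_generic d : exists q : {mpoly F[N.+1]}, q != 0 /\
    forall a b, q.[: a] != 0 -> q.[: b] != 0 -> E d a -> E d b.
  (* In an environment, the coefficients of the hyperplane come first, then the
     coordinates of d candidate points, point by point. *)
  pose pos (j : 'I_d) (i : 'I_N) := (N.+1 + mxvec_index j i)%N.
  pose pt (j : 'I_d) (e : seq F) : 'rV[F]_N := \row_i e`_(pos j i).
  pose Q e := {in enum 'I_d, forall j, {in ps, forall p, p.[: pt j e] = 0} /\
     e`_0 + \sum_(i < N) e`_i.+1 * (pt j e) 0 i = 0 /\
     {in enum 'I_d, forall j', ~ (j <> j' /\
        {in enum 'I_N, forall i, (pt j e) 0 i - (pt j' e) 0 i = 0})}}.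
  pose P e := exists2 e', {in [predC iota N.+1 (d * N)], GRing.same_env e e'} & Q e'.
  have coordP j i : polynomial_in_env (fun e => (pt j e) 0 i).
    by exists (GRing.Var F (pos j i)) => // e; rewrite mxE.
  have QP : definable Q.
    apply: definable_forall => j; apply: definable_and.
      by apply: definable_forall => p; apply/definable_eq0/polynomial_meval.
    apply: definable_and.
      apply/definable_eq0/polynomial_add; first exact: polynomial_var.
      by apply: polynomial_sum => i; apply: polynomial_mul => //; exact: polynomial_var.
    apply: definable_forall => j'; apply/definable_not/definable_and.
      by exists (GRing.Bool (j != j')) => //= e; split=> [/eqP|?]; last exact/eqP.
    apply: definable_forall => i; apply/definable_eq0/polynomial_add => //.
    under eq_fun do rewrite -mulN1r.
    by apply: polynomial_mul => //; exact: polynomial_const.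
  have same_pos (e e' : seq F) k : {in [predC iota N.+1 (d * N)], GRing.same_env e e'} ->
      (k <= N)%N -> e`_k = e'`_k.
    by move=> ee' lek; apply: ee'; rewrite inE mem_iota; lia.
  have env0 (a : 'rV[F]_N.+1) : (env a)`_0 = a 0 ord0 := nth_env a ord0.
  have envS (a : 'rV[F]_N.+1) (i : 'I_N) : (env a)`_i.+1 = a 0 (lift ord0 i) :=
    nth_env a (lift ord0 i).
  have PE a : P (env a) <-> E d a.
    split=> [[e' ee' Qe'] | [u [u_inj uZ]]].
      exists (fun j => pt j e'); split=> [j j' ejj'|j].
        have [_ [_ /(_ j')]] := Qe' j (mem_enum _ j).
        rewrite mem_enum => /(_ isT) H; apply: contrapT => njj'; apply: H; split=> // i _.
        by rewrite ejj' subrr.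
      have [ps0 [hyp0 _]] := Qe' j (mem_enum _ j); split; first by rewrite ZE.
      rewrite /hyperplane /= -[RHS]hyp0 -(same_pos _ _ 0%N ee') // -env0.
      congr (_ + _); apply: eq_bigr => i _.
      by rewrite -(same_pos _ _ i.+1 ee') // -envS.
    pose U : 'M[F]_(d, N) := \matrix_(j, i) u j 0 i.
    pose e' := env a ++ env (mxvec U).
    have size_env K (v : 'rV[F]_K) : size (env v) = K by rewrite size_map size_enum_ord.
    have low k : (k <= N)%N -> e'`_k = (env a)`_k.
      by move=> lek; rewrite nth_cat size_env ltnS lek.
    have pt_u j : pt j e' = u j.
      apply/rowP => i; rewrite mxE nth_cat size_env ifN -?leqNgt ?leq_addr //.
      by rewrite addKn nth_env mxvecE mxE.
    exists e' => [k|j _].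
      rewrite !inE mem_iota => ke; have [lek|gtk] := leqP k N; first by rewrite low.
      by rewrite !nth_default // ?size_cat ?size_env; lia.
    have [Zu hu] := uZ j; split; first by move: Zu; rewrite pt_u ZE.
    split=> [|j' _ [njj' eq]].
      rewrite -[RHS]hu pt_u low // env0; congr (_ + _).
      by apply: eq_bigr => i _; rewrite low // envS.
    apply: njj'; apply: u_inj; rewrite -!pt_u; apply/rowP => i.
    by apply/eqP; rewrite -subr_eq0; apply/eqP/eq/mem_enum.
  have [q q0' qP] := generic_truth N.+1 (definable_exists (iota N.+1 (d * N)) QP).
  by exists q; split=> // a b qa qb /PE Pa; apply/PE; exact: qP Pa.
have {E_generic} [q qP] := choice E_generic.
pose r := q0 * \prod_(d < D.+2) q d.
have r0 : r != 0 by rewrite mulf_neq0 //; apply/prodf_neq0 => d _; have [] := qP d.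
have rP a : r.[: a] != 0 -> q0.[: a] != 0 /\ forall d, (d < D.+2)%N -> (q d).[: a] != 0.
  rewrite mevalM mulf_eq0 negb_or rmorph_prod => /andP[-> /prodf_neq0 qa].
  by split=> // d ltd; exact: (qa (Ordinal ltd)).
have [[a ra]|no_a] := pselect (exists a : 'rV[F]_N.+1, r.[: a] != 0); last first.
  by exists 0%N => //; exists r => // a ra; case: no_a; exists a.
have [q0a qa] := rP _ ra.
have exE : exists d, `[< E d a >].
  by exists 0%N; apply/asboolP; exists (fun i : 'I_0 => 0); split=> -[].
have leE d : `[< E d a >] -> (d <= D)%N.
  by move=> /asboolP[u [u_inj uZ]]; exact: bound q0a _ _ u_inj uZ.
have [d /asboolP Ed maxd] := ex_maxnP exE leE.
have led : (d <= D)%N by apply/leE/asboolP.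
exists d => //; exists r => // b rb; have [_ qb] := rP _ rb.
have same k : (k < D.+2)%N -> E k b <-> E k a.
  by move=> ltk; have [_ H] := qP k; split; apply: H; rewrite ?qa ?qb.
apply: card_eq_II_injective; first by apply/same => //; lia.
by move=> /(same d.+1 led)/asboolP/maxd; rewrite ltnn.
Qed.

(** * Positive definite matrices *)

(** Symmetric Gaussian elimination: the Schur complement of the top left entry is
    again positive definite. *)
Lemma pdmx_diagonalizable (R : realFieldType) (n : nat) (X : 'M[R]_n) : pdmx X ->
  exists P : 'M[R]_n, exists d : 'rV[R]_n,
    [/\ P \in unitmx, forall i, 0 < d 0 i & X = P^T *m diag_mx d *m P].
Proof.
elim: n X => [|n IH] X [Xs Xp].
  exists 0, 0; split; last by apply/matrixP => -[].
    by rewrite unitmxE det_mx00 unitr1.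
  by case.
rewrite -[n.+1]/(1 + n)%N in X Xs Xp *.
pose a := X 0 0; pose r : 'rV_n := ursubmx X; pose Y := drsubmx X.
have XE : X = block_mx a%:M r r^T Y.
  rewrite -[LHS]submxK; congr block_mx.
    by rewrite [ulsubmx X]mx11_scalar !mxE; congr (X _ _)%:M; apply: val_inj.
  by rewrite trmx_ursub Xs.
have form (c : 'M[R]_1) (v : 'cV[R]_n) :
    (col_mx c v)^T *m X *m col_mx c v =
    c^T *m a%:M *m c + v^T *m r^T *m c + (c^T *m r *m v + v^T *m Y *m v).
  by rewrite XE tr_col_mx mul_row_block mul_row_col !mulmxDl.
have a0 : 0 < a.
  have nz : col_mx 1%:M 0 != 0 :> 'cV[R]_(1 + n).
    by rewrite col_mx_eq0 negb_and oner_eq0.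
  have := Xp _ nz; rewrite form trmx1 trmx0 !mul0mx !mulmx0 !addr0 mul1mx mulmx1.
  by rewrite mxE eqxx mulr1n.
have an0 : a != 0 by rewrite gt_eqF.
have Ysym : Y^T = Y by rewrite trmx_drsub Xs.
have [|P' [d' [uP' d'0 YE]]] := IH (Y - a^-1 *: (r^T *m r)).
  split=> [|v v0].
    by rewrite linearB linearZ /= trmx_mul trmxK Ysym.
  have nz : col_mx (- a^-1 *: (r *m v)) v != 0.
    by rewrite col_mx_eq0 negb_and v0 orbT.
  have := Xp _ nz; rewrite form.
  set c := - a^-1 *: (r *m v).
  have cT : c^T = - a^-1 *: (v^T *m r^T).
    by rewrite /c linearZ /= trmx_mul.
  pose w := v^T *m (r^T *m r) *m v.
  have -> : v^T *m r^T *m c = - a^-1 *: w by rewrite /c /w -scalemxAr !mulmxA.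
  have -> : c^T *m a%:M *m c = a^-1 *: w.
    rewrite mul_mx_scalar cT /c /w -!scalemxAl -scalemxAr !scalerA !mulmxA.
    by congr (_ *: _); field.
  have -> : c^T *m r *m v = - a^-1 *: w by rewrite cT /w -!scalemxAl !mulmxA.
  rewrite scaleNr addrN add0r addrC mulmxBr mulmxBl /w.
  by rewrite -(scalemxAr a^-1) -(scalemxAl a^-1).
pose P : 'M[R]_(1 + n) := block_mx 1%:M (a^-1 *: r) 0 P'.
exists P, (row_mx a%:M d'); split.
- by rewrite unitmxE det_ublock det1 mul1r -unitmxE.
- by move=> i; rewrite mxE; case: split => j; rewrite ?d'0 // ord1 mxE eqxx mulr1n.
rewrite XE diag_mx_row tr_block_mx !mulmx_block trmx1 trmx0.
have -> : diag_mx a%:M = a%:M :> 'M_1 by apply/matrixP => i j; rewrite !ord1 !mxE.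
rewrite !mul0mx !mulmx0 !addr0 !add0r !mul1mx !mulmx1 -YE.
have -> : (a^-1 *: r)^T = a^-1 *: r^T by rewrite linearZ.
rewrite mul_scalar_mx mul_mx_scalar mul0mx addr0 !scalerA ?mulfV ?mulVf // !scale1r.
by congr block_mx; rewrite -scalemxAr addrC subrK.
Qed.

Lemma pd_trace_form_eq0 (R : realFieldType) (n p : nat) (X : 'M[R]_n) (V : 'M[R]_(n, p)) :
  pdmx X -> \tr (V^T *m X *m V) = 0 -> V = 0.
Proof.
move=> [_ Xp] /eqP; rewrite /mxtrace.
have diagE k : (V^T *m X *m V) k k = ((col k V)^T *m X *m col k V) 0 0.
  rewrite mxE [RHS]mxE; apply: eq_bigr => i _; congr (_ * _); last by rewrite mxE.
  by rewrite mxE [RHS]mxE; apply: eq_bigr => l _; rewrite !mxE.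
have ge0 k : 0 <= (V^T *m X *m V) k k.
  rewrite diagE; have [->|/Xp/ltW//] := eqVneq (col k V) 0.
  by rewrite mulmx0 mxE.
rewrite psumr_eq0 // => /allP z; apply/matrixP => i j; rewrite mxE.
have /eqP := z j (mem_index_enum j); rewrite diagE.
have [c0 _|/Xp] := eqVneq (col j V) 0; last by rewrite lt0r => /andP[/eqP].
by move/colP/(_ i): c0; rewrite !mxE.
Qed.

(** With X = P^T diag(d) P and G = P D P^T, the trace is the sum of
    d_i d_j G_ij^2. *)
Lemma pd_trace_square_eq0 (R : realFieldType) (n : nat) (X D : 'M[R]_n) :
  pdmx X -> D^T = D -> \tr (X *m D *m X *m D) = 0 -> D = 0.
Proof.
move=> Xpd Ds tr0; have [P [d [uP d0 XE]]] := pdmx_diagonalizable Xpd.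
have [G GE] : exists G, G = P *m D *m P^T by exists (P *m D *m P^T).
have Gs : G^T = G by rewrite GE !trmx_mul trmxK Ds mulmxA.
have : \tr (diag_mx d *m G *m (diag_mx d *m G)) == 0.
  rewrite -[0]tr0 XE GE -!mulmxA [\tr (P^T *m _)]mxtrace_mulC -!mulmxA.
  by rewrite !mulmxA.
rewrite /mxtrace (eq_bigr (fun i => \sum_j d 0 i * d 0 j * G i j ^+ 2)) => [|i _]; last first.
  rewrite mxE; apply: eq_bigr => j _; rewrite !mul_diag_mx !mxE.
  by have := congr1 (fun M : 'M_n => M i j) Gs; rewrite mxE => ->; ring.
have ge0 i j : 0 <= d 0 i * d 0 j * G i j ^+ 2 by rewrite mulr_ge0 ?sqr_ge0 // mulr_ge0 // ltW.
rewrite psumr_eq0 => [/allP z|i _]; last exact: sumr_ge0.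
have G0 : G = 0.
  apply/matrixP => i j; have := z i (mem_index_enum i).
  rewrite psumr_eq0 // => /allP/(_ j (mem_index_enum j)).
  by rewrite mulf_eq0 [_ * _ == 0]gt_eqF ?mulr_gt0 //= sqrf_eq0 mxE => /eqP.
have uPT : P^T \in unitmx by rewrite unitmx_tr.
by rewrite -[D](mulKmx uP) -[P *m D](mulmxK uPT) -GE G0 mul0mx mulmx0.
Qed.

(** * The symmetrised central path equations *)

(** A symmetric matrix is stored by its entries with i <= j, so the entry (i, j) is read
    at the sorted pair. *)
Definition sort_pair (n : nat) (i j : 'I_n) : 'I_n * 'I_n :=
  if (i <= j)%N then (i, j) else (j, i).

Lemma sort_pair_triu n (i j : 'I_n) : sort_pair i j \in triu n.
Proof. by rewrite /sort_pair inE; case: (leqP i j) => //= /ltnW. Qed.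

Definition triu_index (n : nat) (i j : 'I_n) : 'I_('C(n.+1, 2)) :=
  cast_ord (card_triu n) (enum_rank_in (sort_pair_triu i j) (sort_pair i j)).

Definition smat (R : Type) (n : nat) (x : 'rV[R]_('C(n.+1, 2))) : 'M[R]_n :=
  \matrix_(i, j) x 0 (triu_index i j).

Lemma sort_pairC n (i j : 'I_n) : sort_pair i j = sort_pair j i.
Proof. by rewrite /sort_pair; case: ltngtP => // /val_inj->. Qed.

Lemma triu_indexK n (i j : 'I_n) :
  enum_val (cast_ord (esym (card_triu n)) (triu_index i j)) = sort_pair i j.
Proof. by rewrite cast_ordK enum_rankK_in // sort_pair_triu. Qed.

Lemma triu_indexC n (i j : 'I_n) : triu_index i j = triu_index j i.
Proof.
apply: (can_inj (cast_ordKV (card_triu n))); apply: (@enum_val_inj _ (triu n)).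
by rewrite !triu_indexK sort_pairC.
Qed.

Lemma trmx_smat (R : Type) n (x : 'rV[R]_('C(n.+1, 2))) : (smat x)^T = smat x.
Proof. by apply/matrixP => i j; rewrite !mxE triu_indexC. Qed.

Lemma svecK (R : Type) n (X : 'M[R]_n) : X^T = X -> smat (svec X) = X.
Proof.
move=> Xs; apply/matrixP => i j; rewrite !mxE triu_indexK /sort_pair.
by case: leqP => // _; rewrite -[in RHS]Xs mxE.
Qed.

Lemma smatK (R : Type) n (x : 'rV[R]_('C(n.+1, 2))) : svec (smat x) = x.
Proof.
apply/rowP => k; rewrite !mxE /= mxE; congr (x 0 _).
apply: (can_inj (cast_ordKV (card_triu n))); apply: (@enum_val_inj _ (triu n)).
rewrite triu_indexK; set p := enum_val _.
have : p \in triu n by exact: enum_valP.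
by rewrite inE /sort_pair; case: p => i j /= ->.
Qed.

Lemma map_smat (R R' : Type) (f : R -> R') n (x : 'rV[R]_('C(n.+1, 2))) :
  map_mx f (smat x) = smat (map_mx f x).
Proof. by apply/matrixP => i j; rewrite !mxE. Qed.

Lemma map_svec (R R' : Type) (f : R -> R') n (X : 'M[R]_n) :
  map_mx f (svec X) = svec (map_mx f X).
Proof. by apply/rowP => i; rewrite !mxE /= mxE. Qed.

Lemma map_pd_vec (R R' : Type) (f : R -> R') m n (X : 'M[R]_n) (y : 'rV_m) S :
  map_mx f (pd_vec X y S) = pd_vec (map_mx f X) (map_mx f y) (map_mx f S).
Proof. rewrite /pd_vec !map_row_mx !map_svec. by []. Qed.

Section KKT.
Variables (m n : nat).
Local Notation N := (pd_dim m n).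

Definition X_of (R : Type) (x : 'rV[R]_N) : 'M[R]_n := smat (lsubmx x).
Definition y_of (R : Type) (x : 'rV[R]_N) : 'rV[R]_m := lsubmx (rsubmx x).
Definition S_of (R : Type) (x : 'rV[R]_N) : 'M[R]_n := smat (rsubmx (rsubmx x)).

(** The central path equations with the centrality condition symmetrised, so that
    there are as many equations as unknowns.  The parameter t is kept on the
    other side: a central triple satisfies kkt x = t *: centrality_rhs. *)
Definition kkt (R : comNzRingType) (A : 'I_m -> 'M[R]_n) (b : 'rV[R]_m) (C : 'M[R]_n)
    (x : 'rV[R]_N) : 'rV[R]_N :=
  pd_vec (X_of x *m S_of x + S_of x *m X_of x)
    (\row_i (\tr (A i *m X_of x) - b 0 i))
    (\sum_i y_of x 0 i *: A i + S_of x - C).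

Definition kkt_diff (R : comNzRingType) (A : 'I_m -> 'M[R]_n) (x v : 'rV[R]_N) : 'rV[R]_N :=
  pd_vec (X_of x *m S_of v + X_of v *m S_of x + (S_of x *m X_of v + S_of v *m X_of x))
    (\row_i \tr (A i *m X_of v))
    (\sum_i y_of v 0 i *: A i + S_of v).

Definition centrality_rhs (R : comNzRingType) : 'rV[R]_N := pd_vec 2%:M 0 0.

Lemma svecD (R : nmodType) (X Y : 'M[R]_n) : svec (X + Y) = svec X + svec Y.
Proof. by apply/rowP => i; rewrite !mxE /= mxE. Qed.

Lemma svecZ (R : pzRingType) a (X : 'M[R]_n) : svec (a *: X) = a *: svec X.
Proof. by apply/rowP => i; rewrite !mxE /= mxE. Qed.

Lemma pd_vecD (R : nmodType) (X X' : 'M[R]_n) (y y' : 'rV[R]_m) (S S' : 'M[R]_n) :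
  pd_vec X y S + pd_vec X' y' S' = pd_vec (X + X') (y + y') (S + S').
Proof. by rewrite /pd_vec !svecD !add_row_mx. Qed.

Lemma pd_vecZ (R : pzRingType) a (X : 'M[R]_n) (y : 'rV[R]_m) (S : 'M[R]_n) :
  a *: pd_vec X y S = pd_vec (a *: X) (a *: y) (a *: S).
Proof. by rewrite /pd_vec !svecZ !scale_row_mx. Qed.

Lemma X_of_axpy (R : pzRingType) a (x v : 'rV[R]_N) : X_of (x + a *: v) = X_of x + a *: X_of v.
Proof. by apply/matrixP => i j; rewrite !mxE. Qed.

Lemma y_of_axpy (R : pzRingType) a (x v : 'rV[R]_N) : y_of (x + a *: v) = y_of x + a *: y_of v.
Proof. by apply/matrixP => i j; rewrite !mxE. Qed.

Lemma S_of_axpy (R : pzRingType) a (x v : 'rV[R]_N) : S_of (x + a *: v) = S_of x + a *: S_of v.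
Proof. by apply/matrixP => i j; rewrite !mxE. Qed.

Lemma row_axpyE (R : pzRingType) k a (y z : 'rV[R]_k) i :
  (y + a *: z) 0 i = y 0 i + a * z 0 i.
Proof. by rewrite !mxE. Qed.

Lemma mulmx_expand (R : comNzRingType) a (X X' S S' : 'M[R]_n) :
  (X + a *: X') *m (S + a *: S') =
  X *m S + a *: (X *m S' + X' *m S) + a ^+ 2 *: (X' *m S').
Proof.
rewrite mulmxDl !mulmxDr -!scalemxAl -!scalemxAr scalerA -expr2 scalerDr.
by rewrite !addrA.
Qed.

Lemma mulmx_leibnizD (R : comNzRingType) a (X S Xv Sv Xw Sw : 'M[R]_n) :
  X *m (Sw + a *: Sv) + (Xw + a *: Xv) *m S =
  X *m Sw + Xw *m S + a *: (X *m Sv + Xv *m S).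
Proof. by rewrite mulmxDr mulmxDl -scalemxAr -scalemxAl scalerDr addrACA. Qed.

(** The Taylor formula for the quadratic map kkt; it identifies kkt_diff as the
    derivative. *)
Lemma kkt_expand (R : comNzRingType) (A : 'I_m -> 'M[R]_n) b C a (x v : 'rV[R]_N) :
  kkt A b C (x + a *: v) = kkt A b C x + a *: kkt_diff A x v +
    a ^+ 2 *: pd_vec (X_of v *m S_of v + S_of v *m X_of v) 0 0.
Proof.
rewrite /kkt /kkt_diff !pd_vecZ !pd_vecD X_of_axpy y_of_axpy S_of_axpy; congr pd_vec.
- by rewrite !mulmx_expand addrACA [X in X + _]addrACA -!scalerDr.
- by apply/rowP => i; rewrite !mxE mulmxDr -scalemxAr mxtraceD mxtraceZ mulr0 addr0 addrAC.
- rewrite scaler0 addr0 scalerDr scaler_sumr.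
  under eq_bigr do rewrite row_axpyE scalerDl -scalerA.
  by rewrite big_split /= addrACA; exact: addrAC.
Qed.

Lemma kkt_diff_linear (R : comNzRingType) (A : 'I_m -> 'M[R]_n) x : linear (kkt_diff A x).
Proof.
move=> a v w; rewrite [a *: v + w]addrC [RHS]addrC.
rewrite /kkt_diff pd_vecZ pd_vecD X_of_axpy y_of_axpy S_of_axpy.
congr pd_vec.
- by rewrite !mulmx_leibnizD addrACA -scalerDr.
- by apply/rowP => i; rewrite !mxE mulmxDr -scalemxAr mxtraceD mxtraceZ.
- rewrite scalerDr scaler_sumr; under eq_bigr do rewrite row_axpyE scalerDl -scalerA.
  by rewrite big_split /= addrACA.
Qed.

HB.instance Definition _ (R : comNzRingType) (A : 'I_m -> 'M[R]_n) x :=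
  GRing.isLinear.Build R _ _ _ (kkt_diff A x) (kkt_diff_linear A x).

Lemma map_kkt (R R' : comNzRingType) (f : {rmorphism R -> R'}) A b C (x : 'rV[R]_N) :
  map_mx f (kkt A b C x) =
  kkt (fun i => map_mx f (A i)) (map_mx f b) (map_mx f C) (map_mx f x).
Proof.
rewrite /kkt map_pd_vec /X_of /y_of /S_of; congr pd_vec.
- by rewrite map_mxD !map_mxM !map_smat map_lsubmx !map_rsubmx.
- apply/rowP => i; rewrite !mxE rmorphB -map_lsubmx -map_smat -map_mxM -trace_map_mx.
  by [].
- rewrite map_mxB map_mxD raddf_sum map_smat !map_rsubmx.
  by congr (_ + _ - _); apply: eq_bigr => i _; rewrite /= map_mxZ !mxE.
Qed.

Lemma map_kkt_diff (R R' : comNzRingType) (f : {rmorphism R -> R'}) A (x v : 'rV[R]_N) :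
  map_mx f (kkt_diff A x v) = kkt_diff (fun i => map_mx f (A i)) (map_mx f x) (map_mx f v).
Proof.
rewrite /kkt_diff map_pd_vec /X_of /y_of /S_of; congr pd_vec.
- by rewrite !map_mxD !map_mxM !map_smat !map_lsubmx !map_rsubmx.
- apply/rowP => i; rewrite !mxE -map_lsubmx -map_smat -map_mxM -trace_map_mx.
  by [].
- rewrite map_mxD raddf_sum map_smat !map_rsubmx.
  by congr (_ + _); apply: eq_bigr => i _; rewrite /= map_mxZ !mxE.
Qed.

End KKT.

(** * Nondegeneracy and Newton lifting at central triples *)

Section Nondegenerate.
Variables (m n : nat).
Local Notation N := (pd_dim m n).

Lemma pd_vecK (R : Type) (x : 'rV[R]_N) : pd_vec (X_of x) (y_of x) (S_of x) = x.
Proof. by rewrite /pd_vec !smatK !hsubmxK. Qed.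

Lemma X_of_pd_vec (R : Type) (X : 'M[R]_n) (y : 'rV_m) S : X^T = X -> X_of (pd_vec X y S) = X.
Proof. by move=> Xs; rewrite /X_of row_mxKl svecK. Qed.

Lemma y_of_pd_vec (R : Type) (X : 'M[R]_n) (y : 'rV_m) S : y_of (pd_vec X y S) = y.
Proof. by rewrite /y_of row_mxKr row_mxKl. Qed.

Lemma S_of_pd_vec (R : Type) (X : 'M[R]_n) (y : 'rV_m) S : S^T = S -> S_of (pd_vec X y S) = S.
Proof. by move=> Ss; rewrite /S_of !row_mxKr svecK. Qed.

Lemma smat0 (R : nmodType) k : smat (0 : 'rV[R]_('C(k.+1, 2))) = 0.
Proof. by apply/matrixP => i j; rewrite !mxE. Qed.

Lemma svec0 (R : nmodType) k : svec (0 : 'M[R]_k) = 0.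
Proof. by apply/rowP => i; rewrite !mxE /= mxE. Qed.

Lemma pd_vec_eq0 (R : nmodType) (X : 'M[R]_n) (y : 'rV[R]_m) S :
  X^T = X -> S^T = S -> pd_vec X y S = 0 -> [/\ X = 0, y = 0 & S = 0].
Proof.
move=> Xs Ss /eqP; rewrite /pd_vec !row_mx_eq0 => /and3P[/eqP X0 /eqP-> /eqP S0].
by rewrite -(svecK Xs) -(svecK Ss) X0 S0 smat0.
Qed.

(** Multiplying by W and taking traces leaves twice the trace of W X W. *)
Lemma lyapunov_eq0 (R : realFieldType) (X W : 'M[R]_n) :
  pdmx X -> W^T = W -> X *m W + W *m X = 0 -> W = 0.
Proof.
move=> Xpd Ws XW0; apply: (pd_trace_form_eq0 Xpd); rewrite Ws.
have : \tr ((X *m W + W *m X) *m W) = 0 by rewrite XW0 mul0mx mxtrace0.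
rewrite mulmxDl mxtraceD -mulmxA mxtrace_mulC -[W *m W *m X]mulmxA [\tr (W *m _)]mxtrace_mulC.
by move/eqP; rewrite -mulr2n mulrn_eq0 => /eqP.
Qed.

(** The linearised system has only the zero solution at a central triple.  Let (U, w, V)
    be a solution.  The linear constraints make U and V orthogonal.  The centrality
    condition becomes a Lyapunov equation for W = X V X + t U, by S = t X^-1, so that
    X V X = - t U.  Hence tr (X V X V) = - t tr (U V) = 0, which forces V = 0,
    then U = 0, and w = 0 by the independence of the A_i. *)
Lemma kkt_diff_central_eq0 (R : realFieldType) (A : 'I_m -> 'M[R]_n) X y S t (v : 'rV[R]_N) :
  (forall i, (A i)^T = A i) -> free [tuple A i | i < m] ->
  pdmx X -> pdmx S -> X *m S = t%:M -> 0 < t ->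
  kkt_diff A (pd_vec X y S) v = 0 -> v = 0.
Proof.
move=> As Afree Xpd Spd XS t0.
have [Xs _] := Xpd; have [Ss _] := Spd.
have SX : S *m X = t%:M by rewrite -[LHS]trmxK trmx_mul Xs Ss XS tr_scalar_mx.
rewrite /kkt_diff X_of_pd_vec // S_of_pd_vec //.
set U := X_of v; set V := S_of v; set w := y_of v.
have Us : U^T = U by exact: trmx_smat.
have Vs : V^T = V by exact: trmx_smat.
move=> /pd_vec_eq0[||].
- by rewrite !linearD /= !trmx_mul Us Vs Xs Ss addrC [X in X + _]addrC [X in _ + X]addrC.
- rewrite linearD /= Vs raddf_sum; congr (_ + _); apply: eq_bigr => i _.
  by rewrite /= linearZ /= As.
move=> lin1 lin2 lin3.
have trUV : \tr (U *m V) = 0.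
  have -> : V = \sum_i (- w 0 i) *: A i.
    under eq_bigr do rewrite scaleNr.
    by rewrite sumrN; apply/eqP; rewrite -addr_eq0 addrC lin3.
  rewrite mulmx_sumr (big_morph _ (@mxtraceD _ _) (mxtrace0 _ _)) big1 // => i _.
  rewrite -scalemxAr mxtraceZ mxtrace_mulC.
  by have /rowP/(_ i) := lin2; rewrite !mxE => ->; rewrite mulr0.
(* W is (X V + U S) X; multiplying the equation lin1 by X on both sides gives the
   Lyapunov equation for W. *)
pose W := X *m V *m X + t *: U.
have W0 : W = 0.
  apply: (lyapunov_eq0 Xpd).
    by rewrite /W linearD linearZ /= !trmx_mul Us Vs Xs mulmxA.
  have := congr1 (fun M => X *m M *m X) lin1; rewrite mulmx0 mul0mx => <-.
  rewrite /W !(mulmxDl, mulmxDr) -!mulmxA SX !mulmxA XS.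
  rewrite !mul_scalar_mx !mul_mx_scalar -!scalemxAl -!scalemxAr.
  by congr (_ + _); exact: addrC.
have XVX : X *m V *m X = - (t *: U) by apply/eqP; rewrite -addr_eq0; exact/eqP.
have V0 : V = 0.
  apply: (pd_trace_square_eq0 Xpd Vs).
  by rewrite XVX mulNmx raddfN /= -scalemxAl mxtraceZ trUV mulr0 oppr0.
have U0 : U = 0.
  have /eqP := W0; rewrite /W V0 mulmx0 mul0mx add0r scaler_eq0 gt_eqF //=.
  by move=> /eqP.
have w0 : w = 0.
  apply/rowP => i; rewrite [RHS]mxE.
  move/freeP: Afree => /(_ (fun i => w 0 i)) Afree; apply: Afree; rewrite -[RHS]lin3 V0 addr0.
  by apply: eq_bigr => k _; rewrite -tnth_nth tnth_mktuple.
by rewrite -[v]pd_vecK -/U -/V -/w U0 V0 w0 /pd_vec !svec0 !row_mx0.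
Qed.
End Nondegenerate.

(** Newton iteration in powers of eps: if the perturbed equations hold modulo eps^j,
    the correction eps^j v with v solving the linearised system at x makes them hold
    modulo eps^(j+1), since it changes the perturbation eps w_i^3 only by multiples
    of eps^(j+1). *)
Lemma kkt_lift (K : fieldType) (m n : nat) (A : 'I_m -> 'M[K]_n) b C t
    (x : 'rV[K]_(pd_dim m n)) :
  kkt A b C x = t *: centrality_rhs m n K ->
  (forall v, kkt_diff A x v = 0 -> v = 0) ->
  forall j, exists2 w : 'rV[{poly K}]_(pd_dim m n), map_mx (horner_eval 0) w = x &
    forall i, 'X^j %| kkt (fun i => map_mx polyC (A i)) (map_mx polyC b) (map_mx polyC C) w 0 i
        - (t * centrality_rhs m n K 0 i)%:P + 'X * w 0 i ^+ 3.
Proof.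
move=> x_sol x_nondeg.
have surj r : exists v, kkt_diff A x v = r.
  have uJ : lin1_mx (kkt_diff A x) \in unitmx.
    rewrite -row_free_unit; apply: inj_row_free => v.
    by rewrite mul_rV_lin1; exact: x_nondeg.
  by exists (r *m invmx (lin1_mx (kkt_diff A x))); rewrite -mul_rV_lin1 mulmxKV.
pose Ap i := map_mx polyC (A i); pose bp := map_mx polyC b; pose Cp := map_mx polyC C.
pose res (w : 'rV[{poly K}]_(pd_dim m n)) i :=
  kkt Ap bp Cp w 0 i - (t * centrality_rhs m n K 0 i)%:P + 'X * w 0 i ^+ 3.
have at0 k l (M : 'M[K]_(k, l)) : map_mx (horner_eval 0) (map_mx polyC M) = M.
  by apply/matrixP => i i'; rewrite !mxE /horner_eval hornerC.
suff lift j : exists2 w : 'rV[{poly K}]_(pd_dim m n),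
    map_mx (horner_eval 0) w = x & forall i, ('X^(j.+1) %| res w i)%R.
  by move=> j; have [w wx wP] := lift j; exists w => // i;
     apply: dvdp_trans (wP i); exact: dvdp_exp2l.
elim: j => [|j [w wx wP]].
  exists (map_mx polyC x) => [|i]; first exact: at0.
  rewrite /res -map_kkt x_sol !mxE subrr add0r expr1; exact: dvdp_mulr.
have [q qP] : exists q, forall i, res w i = q i * 'X^(j.+1).
  suff [q qP] : exists q, forall i, res w i = 'X^(j.+1) * q i by exists q => i; rewrite mulrC.
  have [q qP] := choice (fun i => dvdpP _ _ (wP i)).
  by exists q => i; rewrite qP mulrC.
have [v vP] := surj (- \row_i (q i).[0]).
pose vp := map_mx polyC v.
exists (w + 'X^(j.+1) *: vp) => [|i].
  rewrite -[RHS]wx; apply/rowP => i.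
  by rewrite !mxE /horner_eval hornerD hornerM hornerXn expr0n mul0r addr0.
rewrite /res kkt_expand.
pose e1 := kkt_diff Ap w vp 0 i.
pose e2 := pd_vec (X_of vp *m S_of vp + S_of vp *m X_of vp) (0 : 'rV_m) 0 0 i.
have -> : (kkt Ap bp Cp w + 'X^(j.+1) *: kkt_diff Ap w vp +
    ('X^(j.+1)) ^+ 2 *: pd_vec (X_of vp *m S_of vp + S_of vp *m X_of vp) 0 0) 0 i =
    kkt Ap bp Cp w 0 i + 'X^(j.+1) * e1 + ('X^(j.+1)) ^+ 2 * e2.
  by rewrite !row_axpyE.
have -> : (w + 'X^(j.+1) *: vp) 0 i = w 0 i + 'X^(j.+1) * (v 0 i)%:P.
  by rewrite row_axpyE [vp 0 i]mxE.
have diff_at0 : map_mx (horner_eval 0) (kkt_diff Ap w vp) = - \row_i (q i).[0].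
  rewrite map_kkt_diff wx at0 -vP; congr (kkt_diff _ x v).
  by apply/funext => k; exact: at0.
have e1_at0 : e1.[0] = - (q i).[0].
  transitivity (map_mx (horner_eval 0) (kkt_diff Ap w vp) 0 i); first by rewrite mxE.
  by rewrite diff_at0 [LHS]mxE mxE.
have X_dvd : 'X %| q i + e1.
  by rewrite -['X]subr0 -polyC0 dvdp_XsubCl /root hornerD e1_at0 subrr.
set a := w 0 i; set c := (v 0 i)%:P.
have -> : kkt Ap bp Cp w 0 i + 'X^(j.+1) * e1 + 'X^(j.+1) ^+ 2 * e2
    - (t * centrality_rhs m n K 0 i)%:P + 'X * (a + 'X^(j.+1) * c) ^+ 3 =
  res w i + 'X^(j.+1) * e1 + 'X^(j.+2) * ('X^j * e2 +
    (c * (3%:R * a ^+ 2 + 3%:R * a * 'X^(j.+1) * c + ('X^(j.+1) * c) ^+ 2))).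
  by rewrite /res -/a !exprS; ring.
rewrite qP mulrC -mulrDr exprSr; apply: dvdp_add; last exact: dvdp_mulr.
exact: dvdp_mul.
Qed.

(** * The central path equations as polynomials *)

Section KKTPolynomials.
Variables (F : fieldType) (m n : nat) (A : 'I_m -> 'M[int]_n) (b : 'rV[int]_m) (C : 'M[int]_n).
Local Notation N := (pd_dim m n).

Definition intA (R : pzRingType) (i : 'I_m) : 'M[R]_n := map_mx intr (A i).
Definition intb (R : pzRingType) : 'rV[R]_m := map_mx intr b.
Definition intC (R : pzRingType) : 'M[R]_n := map_mx intr C.

(** With integer data the same system makes sense over every commutative ring, and
    ring morphisms preserve it.  It is used over the reals, over the complex
    numbers, and over polynomials. *)
Definition int_kkt (R : comNzRingType) (x : 'rV[R]_N) : 'rV[R]_N :=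
  kkt (intA R) (intb R) (intC R) x.

Lemma map_int_kkt (R R' : comNzRingType) (f : {rmorphism R -> R'}) (x : 'rV[R]_N) :
  map_mx f (int_kkt x) = int_kkt (map_mx f x).
Proof.
have map_int k l (M : 'M[int]_(k, l)) : map_mx f (map_mx intr M) = map_mx intr M.
  by apply/matrixP => i j; rewrite !mxE rmorph_int.
rewrite /int_kkt map_kkt.
have -> : (fun i => map_mx f (intA R i)) = intA R' by apply/funext => i; exact: map_int.
have -> : map_mx f (intb R) = intb R' by exact: map_int.
by rewrite [map_mx f (intC R)]map_int.
Qed.

Definition kkt_poly (i : 'I_N) : {mpoly F[N]} := int_kkt (\row_j 'X_j) 0 i.

Lemma eval_eps_kkt_poly (w : 'rV[{poly F}]_N) i : eval_eps w (kkt_poly i) = int_kkt w 0 i.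
Proof.
rewrite /eval_eps /kkt_poly; set f := mmap _ _.
transitivity (map_mx f (int_kkt (\row_j 'X_j)) 0 i); first by rewrite [RHS]mxE.
rewrite map_int_kkt; suff -> : map_mx f (\row_j 'X_j) = w by [].
by apply/rowP => j; rewrite !mxE /f mmapX mmap1U.
Qed.

Lemma kkt_poly_quadratic i : (msize (kkt_poly i) <= 3)%N.
Proof.
pose x : 'rV[{mpoly F[N]}]_N := \row_j 'X_j.
have x2 j : (msize (x ord0 j) <= 2)%N by rewrite mxE msizeX mdeg1.
have X2 k l : (msize (X_of x k l) <= 2)%N by rewrite mxE [lsubmx _ _ _]mxE.
have S2 k l : (msize (S_of x k l) <= 2)%N by rewrite mxE [rsubmx _ _ _]mxE [rsubmx _ _ _]mxE.
have y2 k : (msize (y_of x ord0 k) <= 2)%N by rewrite mxE [rsubmx _ _ _]mxE.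
have int1 (z : int) : (msize (z%:~R : {mpoly F[N]}) <= 1)%N.
  by rewrite -(rmorph_int (@mpolyC N F)) mmeasureC; case: (_ != _).
have leq23 q : (msize q <= 2)%N -> (msize (q : {mpoly F[N]}) <= 3)%N by move/leq_trans; apply.
have leq13 q : (msize q <= 1)%N -> (msize (q : {mpoly F[N]}) <= 3)%N by move/leq_trans; apply.
rewrite /kkt_poly -/x /int_kkt /kkt /pd_vec mxE; case: split => [k|k]; last first.
  rewrite mxE; case: split => {}k.
    rewrite mxE; apply: msizeD_leq; last by rewrite mmeasureN mxE; exact/leq13.
    apply: msize_sum_leq => j; rewrite mxE; apply: msize_sum_leq => l.
    by apply/leq23/(msizeM_leq (a := 0) (b := 1)) => //; rewrite mxE.
  rewrite mxE /=; set p := enum_val _; rewrite mxE; apply: msizeD_leq; last first.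
    by rewrite mxE mmeasureN mxE; exact/leq13.
  rewrite mxE; apply: msizeD_leq; last exact/leq23.
  rewrite summxE; apply: msize_sum_leq => j; rewrite mxE.
  by apply/leq23/(msizeM_leq (a := 1) (b := 0)) => //; rewrite mxE.
rewrite mxE /=; set p := enum_val _; rewrite mxE; apply: msizeD_leq;
  by rewrite mxE; apply: msize_sum_leq => l; apply: (msizeM_leq (a := 1) (b := 1)).
Qed.

End KKTPolynomials.

Lemma map_centrality_rhs (R R' : comNzRingType) (f : {rmorphism R -> R'}) m n :
  map_mx f (centrality_rhs m n R) = centrality_rhs m n R'.
Proof. by rewrite /centrality_rhs map_pd_vec map_scalar_mx !map_mx0 rmorph_nat. Qed.

(** The Newton lift is made over the reals, where positive definiteness gives
    nondegeneracy, and then carried to the complex numbers. *)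
Lemma central_cubic_lift (R : rcfType) (m n : nat)
    (A : 'I_m -> 'M[int]_n) (b : 'rV[int]_m) (C : 'M[int]_n) (t : R) X y S :
  (forall i, (A i)^T = A i) -> free [tuple intA A R i | i < m] -> 0 < t ->
  central (intA A R) (intb b R) (intC C R) t X y S ->
  forall j, exists2 w : 'rV[{poly R[i]}]_(pd_dim m n),
    map_mx (horner_eval 0) w = map_mx (real_complex R) (pd_vec X y S) &
    cubic_solution (@kkt_poly _ m n A b C) (fun i => centrality_rhs m n R[i] 0 i)
      (real_complex R t) j w.
Proof.
move=> As Afree t0 [prim dual XS Xpd Spd] j.
have [Xs _] := Xpd; have [Ss _] := Spd.
have SX : S *m X = t%:M by rewrite -[LHS]trmxK trmx_mul Xs Ss XS tr_scalar_mx.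
have AsR i : (intA A R i)^T = intA A R i.
  by rewrite /intA -[in RHS]As; apply/matrixP => k l; rewrite !mxE.
have sol : kkt (intA A R) (intb b R) (intC C R) (pd_vec X y S) = t *: centrality_rhs m n R.
  rewrite /kkt /centrality_rhs pd_vecZ X_of_pd_vec // S_of_pd_vec // y_of_pd_vec !scaler0.
  congr pd_vec.
  - by rewrite XS SX scale_scalar_mx mulr_natr mulr2n raddfD.
  - by apply/rowP => i; rewrite !mxE prim mxE subrr.
  - by rewrite dual subrr.
have nondeg v : kkt_diff (intA A R) (pd_vec X y S) v = 0 -> v = 0.
  exact: (kkt_diff_central_eq0 AsR Afree Xpd Spd XS t0).
have [w wx wP] := kkt_lift sol nondeg j.
have map_int k l (M : 'M[int]_(k, l)) :
    map_mx polyC (map_mx intr M) = map_mx intr M :> 'M[{poly R}]_(k, l).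
  by apply/matrixP => i' j'; rewrite !mxE rmorph_int.
have eA : (fun i => map_mx polyC (intA A R i)) = intA A {poly R}.
  by apply/funext => i; exact: map_int.
have {eA map_int} kktE : kkt (fun i => map_mx polyC (intA A R i)) (map_mx polyC (intb b R))
    (map_mx polyC (intC C R)) w = int_kkt A b C w.
  by rewrite eA [map_mx _ (intb b R)]map_int [map_mx _ (intC C R)]map_int.
rewrite {}kktE in wP.
pose h := map_poly (real_complex R).
exists (map_mx h w) => [|i].
  rewrite -wx; apply/rowP => i; rewrite !mxE /horner_eval /h.
  by rewrite -[in LHS](rmorph0 (real_complex R)) horner_map.
rewrite eval_eps_kkt_poly.
have -> : int_kkt A b C (map_mx h w) 0 i = h (int_kkt A b C w 0 i).
  by rewrite -map_int_kkt [LHS]mxE.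
have -> : centrality_rhs m n R[i] 0 i = real_complex R (centrality_rhs m n R 0 i).
  by rewrite -(map_centrality_rhs (real_complex R)) [LHS]mxE.
have := wP i; rewrite -(dvdp_map (real_complex R)) map_polyXn.
rewrite rmorphD rmorphB /= (rmorphM _ 'X) rmorphXn /= map_polyC map_polyX /=.
by rewrite [map_mx h w 0 i]mxE -rmorphM.
Qed.

Definition affine_form (F : fieldType) (N : nat) (a : 'rV[F]_N.+1) : {mpoly F[N]} :=
  (a 0 ord0)%:MP + \sum_i a 0 (lift ord0 i) *: 'X_i.

Lemma meval_affine_form (F : fieldType) (N : nat) (a : 'rV[F]_N.+1) (z : 'rV[F]_N) :
  (affine_form a).[: z] = a 0 ord0 + \sum_i a 0 (lift ord0 i) * z 0 i.
Proof.
rewrite mevalD mevalC raddf_sum; congr (_ + _); apply: eq_bigr => i _ /=.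
by rewrite mevalZ mevalXU.
Qed.

Lemma msize_affine_form (F : fieldType) (N : nat) (a : 'rV[F]_N.+1) :
  (msize (affine_form a) <= 2)%N.
Proof.
apply: leq_trans (mmeasureD_le _ _ _) _; rewrite geq_max mmeasureC (leq_trans (leq_b1 _)) //.
apply: leq_trans (mmeasure_sum _ _ _ _) _; apply/bigmax_leqP => i _.
by apply: leq_trans (msizeZ_le _ _) _; rewrite msizeX mdeg1.
Qed.

(** The value of an affine form at a fixed point is a nonzero linear form in its
    coefficients. *)
Lemma generic_hyperplane_avoids (F : fieldType) (N : nat) (vs : seq 'rV[F]_N) :
  exists2 q : {mpoly F[N.+1]}, q != 0 &
    forall a, q.[: a] != 0 -> {in vs, forall v, (affine_form a).[: v] != 0}.
Proof.
pose f (v : 'rV[F]_N) : {mpoly F[N.+1]} := 'X_ord0 + \sum_i v 0 i *: 'X_(lift ord0 i).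
have fE v a : (f v).[: a] = (affine_form a).[: v].
  rewrite meval_affine_form mevalD mevalXU raddf_sum; congr (_ + _).
  by apply: eq_bigr => i _; rewrite /= mevalZ mevalXU mulrC.
exists (\prod_(v <- vs) f v) => [|a].
  rewrite prodf_seq_neq0; apply/allP => v _; apply/implyP => _.
  apply: contraTneq (oner_neq0 F) => f0; rewrite negbK.
  have := fE v (delta_mx 0 0).
  rewrite f0 meval0 meval_affine_form mxE !eqxx big1 ?addr0 => [z|i _].
    by apply/eqP; exact: esym z.
  by rewrite mxE andbF mul0r.
rewrite rmorph_prod prodf_seq_neq0 => /allP fa v vvs.
by have := fa v vvs; rewrite /= fE.
Qed.

(** * The degree of the central path *)

Theorem theorem3p7 :
  exists2 c : nat, (0 < c)%N &
  forall (R : realType) (m n : nat)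
    (A : 'I_m -> 'M[int]_n) (b : 'rV[int]_m) (C : 'M[int]_n),
  (forall i, (A i)^T = A i) -> C^T = C ->
  let AR := fun i => map_mx intr (A i) : 'M[R]_n in
  let bR := map_mx intr b : 'rV[R]_m in
  let CR := map_mx intr C : 'M[R]_n in
  free [tuple AR i | i < m] ->
  (exists (X : 'M[R]_n) (y : 'rV[R]_m) (S : 'M[R]_n),
      [/\ feasible AR bR CR X y S, pdmx X & pdmx S]) ->
  exists2 mu0 : R, 0 < mu0 &
  forall mu : R, 0 < mu <= mu0 ->
  exists2 d : nat,
    has_degree
      (zariski_closure
         (map_mx (real_complex R) @`
            (central_path AR bR CR @` [set t | 0 < t <= mu]))) d
    & (d <= 2 ^ (c * (m + n ^ 2)))%N.
Proof.
(* 3 ^ N <= 2 ^ (2 * N) and N = m + n * n.+1 <= m + 2 * n ^ 2 give the constant 4. *)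
exists 4%N => // R m n A b C As _ AR bR CR AR_free _; exists 1 => // mu _.
set K := _ @` _.
have K_lift v : K v -> v = 0 \/ exists t, forall j, exists2 w : 'rV[{poly R[i]}]_(pd_dim m n),
    map_mx (horner_eval 0) w = v &
    cubic_solution (@kkt_poly _ m n A b C) (fun i => centrality_rhs m n R[i] 0 i) t j w.
  move=> [x [t /andP[t0 _] <-] <-]; rewrite /central_path.
  case: xgetP => [[[X y] S] _ /= cen | _ /=].
    right; exists (real_complex R t); exact: central_cubic_lift As AR_free t0 cen.
  by left; rewrite /pd_vec !svec0 !row_mx0 map_mx0.
have K_hilbert := independent_card_bound (kkt_poly_quadratic _ A b C) K_lift.
have [vs _ vs_regular] := ex_nonzerodivisor_points K.
have [q q0 q_avoids] := generic_hyperplane_avoids vs.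
have [ps psE] := zariski_closure_finite K.
have [|d Kd led] := has_degree_of_section_bound (D := (3 ^ pd_dim m n)%N) psE q0.
  move=> a qa M u u_inj uKa.
  apply: (closure_section_bound K_hilbert (msize_affine_form a)) u_inj _ _.
  - exact: vs_regular (q_avoids a qa).
  - by move=> i; have [] := uKa i.
  - by move=> i; rewrite meval_affine_form; have [] := uKa i.
exists d => //; apply: leq_trans led _.
apply: (@leq_trans (4 ^ pd_dim m n)%N).
  by case: (posnP (pd_dim m n)) => [->//|N0]; rewrite leq_exp2r.
rewrite -[4%N]/(2 ^ 2)%N -expnM leq_exp2l // pd_dimE.
nia.
Qed.
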